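(* Let $G$ be a reduced self-small abelian group of finite torsion-free rank without nonzero free direct summands, and suppose that the torsion-free rank of $G$ is at most $4$. If $G$ has the cancellation property, then the Walk-endomorphism ring $\mathrm{End}_{\mathrm{W}}(G)=\mathrm{End}(G)/\mathrm{Hom}(G,T(G))$ has the unit lifting property.
   Context: All groups are abelian. $T(G)$ is the torsion part of $G$. The torsion-free rank of $G$ is $r_0(G)=\dim_{\mathbb{Q}}(\mathbb{Q}\otimes G)$. A group $G$ is self-small if for every set $I$ the canonical homomorphism $\mathrm{Hom}(G,G)^{(I)}\to \mathrm{Hom}(G,G^{(I)})$ is an isomorphism. A group is reduced if it has no nonzero divisible subgroup. A group $G$ has the cancellation property if whenever $H,K$ are (abelian) groups with $G\oplus H\cong G\oplus K$, it follows that $H\cong K$. The Walk-endomorphism ring of $G$ is the quotient ring $\mathrm{End}_{\mathrm{W}}(G)=\mathrm{End}(G)/\mathrm{Hom}(G,T(G))$, where $\mathrm{Hom}(G,T(G))$ is viewed as the ideal of endomorphisms with image in $T(G)$. A ring $R$ has the unit lifting property if for every positive integer $n$ every unit of $R/nR$ can be lifted to a unit of $R$. *)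

(* Defs.v *)
From HB Require Import structures.
From mathcomp Require Import all_boot all_order all_algebra.
From mathcomp Require Import generic_quotient ring_quotient.
From mathcomp Require Import boolp classical_sets functions cardinality.

Set Implicit Arguments.
Unset Strict Implicit.
Unset Printing Implicit Defensive.

Import GRing.Theory.
Local Open Scope ring_scope.

(* Abelian groups are [zmodType]s: the decidable equality and the choice
   operator that [zmodType] carries exist on every type by the axioms of
   [boolp]. *)

Definition group_iso (A B : zmodType) : Prop :=
  exists f : {additive A -> B}, bijective f.

Definition torsion_elt (G : zmodType) (x : G) : Prop :=
  exists2 n : nat, (0 < n)%N & x *+ n = 0.

Lemma additive_ext (A B : zmodType) (f g : {additive A -> B}) :
  f =1 g -> f = g.
Proof.
case: f g => [f [[fP]]] [g [[gP]]] /= /funext fg.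
by case: g / fg gP => gP; rewrite (Prop_irrelevance fP gP).
Qed.

HB.instance Definition _ (A B : zmodType) := gen_eqMixin {additive A -> B}.
HB.instance Definition _ (A B : zmodType) := gen_choiceMixin {additive A -> B}.

Section HomZmodule.
Variables A B : zmodType.
Implicit Types f g h : {additive A -> B}.

Definition hom_zero : {additive A -> B} := (\0 : A -> B).
Definition hom_opp f : {additive A -> B} := \- f.
Definition hom_add f g : {additive A -> B} := f \+ g.

Fact hom_addA : associative hom_add.
Proof. by move=> f g h; apply: additive_ext => x /=; rewrite addrA. Qed.

Fact hom_addC : commutative hom_add.
Proof. by move=> f g; apply: additive_ext => x /=; rewrite addrC. Qed.

Fact hom_add0 : left_id hom_zero hom_add.
Proof. by move=> f; apply: additive_ext => x /=; rewrite add0r. Qed.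

Fact hom_addN : left_inverse hom_zero hom_opp hom_add.
Proof. by move=> f; apply: additive_ext => x /=; rewrite addNr. Qed.

HB.instance Definition _ := GRing.isZmodule.Build {additive A -> B}
  hom_addA hom_addC hom_add0 hom_addN.

End HomZmodule.

(* [pzRingType], because End(G) is the zero ring when G = 0. *)
Definition End (G : zmodType) : Type := {additive G -> G}.
HB.instance Definition _ (G : zmodType) := GRing.Zmodule.on (End G).

Section EndRing.
Variable G : zmodType.
Implicit Types f g h : End G.

Definition end_one : End G := (idfun : {additive G -> G}).
Definition end_mul f g : End G :=
  ((f : {additive G -> G}) \o (g : {additive G -> G}) : {additive G -> G}).

Fact end_mulA : associative end_mul.
Proof. by move=> f g h; apply: additive_ext. Qed.

Fact end_mul1 : left_id end_one end_mul.
Proof. by move=> f; apply: additive_ext. Qed.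

Fact end_1mul : right_id end_one end_mul.
Proof. by move=> f; apply: additive_ext. Qed.

Fact end_mulDl : left_distributive end_mul +%R.
Proof. by move=> f g h; apply: additive_ext. Qed.

Fact end_mulDr : right_distributive end_mul +%R.
Proof. by move=> f g h; apply: additive_ext => x /=; rewrite raddfD. Qed.

HB.instance Definition _ := GRing.Zmodule_isPzRing.Build (End G)
  end_mulA end_mul1 end_1mul end_mulDl end_mulDr.

End EndRing.

HB.mixin Record isTwoSidedIdeal (R : pzRingType) (S : R -> bool) := {
  ideal_mull : forall a x : R, S x -> S (a * x);
  ideal_mulr : forall a x : R, S x -> S (x * a)
}.

#[short(type="twoSidedIdeal")]
HB.structure Definition TwoSidedIdeal (R : pzRingType) :=
  {S of GRing.ZmodClosed R S & isTwoSidedIdeal R S}.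

Local Open Scope quotient_scope.

Definition ring_quot (R : pzRingType) (I : twoSidedIdeal R) : Type :=
  Quotient.quot I.
HB.instance Definition _ R I := GRing.Zmodule.on (@ring_quot R I).
HB.instance Definition _ R I := Quotient.on (@ring_quot R I).

Section RingQuotient.
Variables (R : pzRingType) (I : twoSidedIdeal R).

Lemma ring_quot_eqP (x y : R) :
  reflect (\pi_(ring_quot I) x = \pi_(ring_quot I) y) (x - y \in I).
Proof. by rewrite Quotient.idealrBE; exact: eqP. Qed.

Lemma pi_ring_quotD (x y : R) :
  \pi_(ring_quot I) (x + y) = \pi_(ring_quot I) x + \pi_(ring_quot I) y.
Proof. exact: (@Quotient.pi_add R I). Qed.

Definition quot_one : ring_quot I := \pi_(ring_quot I) 1.
Definition quot_mul (u v : ring_quot I) : ring_quot I :=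
  \pi_(ring_quot I) (repr u * repr v).

Lemma pi_ring_quotM (x y : R) :
  \pi_(ring_quot I) (x * y)
  = quot_mul (\pi_(ring_quot I) x) (\pi_(ring_quot I) y).
Proof.
apply/ring_quot_eqP.
set x' := repr _; set y' := repr _.
have hx : x - x' \in I by apply/ring_quot_eqP; rewrite reprK.
have hy : y - y' \in I by apply/ring_quot_eqP; rewrite reprK.
have -> : x * y - x' * y' = (x - x') * y + x' * (y - y').
  by rewrite mulrBl mulrBr addrA subrK.
by apply: rpredD; [exact: ideal_mulr | exact: ideal_mull].
Qed.

Fact quot_mulA : associative quot_mul.
Proof.
elim/quotW=> x; elim/quotW=> y; elim/quotW=> z.
by rewrite -(pi_ring_quotM y z) -(pi_ring_quotM x y) -!pi_ring_quotM mulrA.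
Qed.

Fact quot_mul1 : left_id quot_one quot_mul.
Proof. by elim/quotW=> x; rewrite -pi_ring_quotM mul1r. Qed.

Fact quot_1mul : right_id quot_one quot_mul.
Proof. by elim/quotW=> x; rewrite -pi_ring_quotM mulr1. Qed.

Fact quot_mulDl : left_distributive quot_mul +%R.
Proof.
elim/quotW=> x; elim/quotW=> y; elim/quotW=> z.
by rewrite -pi_ring_quotD -!(pi_ring_quotM _ z) mulrDl pi_ring_quotD.
Qed.

Fact quot_mulDr : right_distributive quot_mul +%R.
Proof.
elim/quotW=> x; elim/quotW=> y; elim/quotW=> z.
by rewrite -pi_ring_quotD -!(pi_ring_quotM x) mulrDr pi_ring_quotD.
Qed.

HB.instance Definition _ := GRing.Zmodule_isPzRing.Build (ring_quot I)
  quot_mulA quot_mul1 quot_1mul quot_mulDl quot_mulDr.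

End RingQuotient.

Definition hom_torsion (G : zmodType) : {pred End G} :=
  fun f => `[< forall x : G, torsion_elt ((f : {additive G -> G}) x) >].

Section HomTorsion.
Variable G : zmodType.

Lemma torsion_elt0 : torsion_elt (0 : G).
Proof. by exists 1%N. Qed.

Lemma torsion_eltB (x y : G) :
  torsion_elt x -> torsion_elt y -> torsion_elt (x - y).
Proof.
move=> [m m0 xm] [n n0 yn]; exists (m * n)%N; first by rewrite muln_gt0 m0.
by rewrite mulrnBl mulrnA xm mul0rn mulnC mulrnA yn mul0rn subrr.
Qed.

Fact hom_torsion_zmod : zmod_closed (@hom_torsion G).
Proof.
split=> [|f g /asboolP fT /asboolP gT]; apply/asboolP => x.
  exact: torsion_elt0.
exact: torsion_eltB.
Qed.

Fact hom_torsion_mull (a f : End G) : hom_torsion f -> hom_torsion (a * f).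
Proof.
move=> /asboolP fT; apply/asboolP => x; have [n n0 fn] := fT x.
exists n => //; transitivity
  ((a : {additive G -> G}) ((f : {additive G -> G}) x *+ n)).
  by rewrite raddfMn.
by rewrite fn raddf0.
Qed.

Fact hom_torsion_mulr (a f : End G) : hom_torsion f -> hom_torsion (f * a).
Proof. by move=> /asboolP fT; apply/asboolP => x; exact: fT. Qed.

HB.instance Definition _ :=
  GRing.isZmodClosed.Build (End G) (@hom_torsion G) hom_torsion_zmod.
HB.instance Definition _ := isTwoSidedIdeal.Build (End G) (@hom_torsion G)
  hom_torsion_mull hom_torsion_mulr.

End HomTorsion.

Definition walk_End (G : zmodType) : pzRingType := ring_quot (@hom_torsion G).

Definition mult_ideal (R : pzRingType) (n : nat) : {pred R} :=
  fun x => `[< exists y : R, x = y *+ n >].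

Section MultIdeal.
Variables (R : pzRingType) (n : nat).

Fact mult_ideal_zmod : zmod_closed (@mult_ideal R n).
Proof.
split=> [|x y /asboolP[x' ->] /asboolP[y' ->]]; apply/asboolP.
  by exists 0; rewrite mul0rn.
by exists (x' - y'); rewrite mulrnBl.
Qed.

Fact mult_ideal_mull (a x : R) : mult_ideal n x -> mult_ideal n (a * x).
Proof.
by move=> /asboolP[y ->]; apply/asboolP; exists (a * y); rewrite mulrnAr.
Qed.

Fact mult_ideal_mulr (a x : R) : mult_ideal n x -> mult_ideal n (x * a).
Proof.
by move=> /asboolP[y ->]; apply/asboolP; exists (y * a); rewrite mulrnAl.
Qed.

HB.instance Definition _ :=
  GRing.isZmodClosed.Build R (@mult_ideal R n) mult_ideal_zmod.
HB.instance Definition _ := isTwoSidedIdeal.Build R (@mult_ideal R n)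
  mult_ideal_mull mult_ideal_mulr.

End MultIdeal.

(* [GRing.unit] is not available on a [pzRingType]. *)
Definition is_unit (R : pzRingType) (u : R) : Prop :=
  exists v : R, u * v = 1 /\ v * u = 1.

Definition unit_lifting (R : pzRingType) : Prop :=
  forall n : nat, (0 < n)%N ->
  forall u : ring_quot (@mult_ideal R n), is_unit u ->
  exists2 v : R, is_unit v & \pi_(ring_quot (@mult_ideal R n)) v = u.

Section DirectSum.
Variables (I : Type) (A : zmodType).

Definition fin_supp : {pred I -> A} :=
  fun f => `[< finite_set [set i | f i <> 0]%classic >].

Fact fin_supp_zmod : zmod_closed fin_supp.
Proof.
split=> [|f g /asboolP fF /asboolP gF]; apply/asboolP.
  by apply: (sub_finite_set _ (finite_set0 I)) => i /=.
have : finite_set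
    ([set i | f i <> 0] `|` [set i | g i <> 0])%classic by rewrite finite_setU.
apply: sub_finite_set => i /= fg0.
have [f0|f0] := EM (f i = 0); last by left.
by right=> g0; apply: fg0; rewrite -[LHS]/(f i - g i) f0 g0 subrr.
Qed.

HB.instance Definition _ :=
  GRing.isZmodClosed.Build (I -> A) fin_supp fin_supp_zmod.

Record dsum : Type := DSum {
  dsum_val :> I -> A;
  dsum_valP : fin_supp dsum_val
}.

HB.instance Definition _ := [isSub for dsum_val].
HB.instance Definition _ := [Choice of dsum by <:].
HB.instance Definition _ := [SubChoice_isSubZmodule of dsum by <:].

End DirectSum.

Section CanonicalHom.
Variables (I : Type) (A B : zmodType) (f : dsum I {additive A -> B}).

Fact canonical_fin_supp (a : A) :
  fin_supp (fun i => (f i : {additive A -> B}) a).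
Proof.
apply/asboolP; have /asboolP := dsum_valP f.
by apply: sub_finite_set => i /= fa0 f0; apply: fa0; rewrite f0.
Qed.

Definition canonical_fun (a : A) : dsum I B := DSum (canonical_fin_supp a).

Fact canonical_fun_morph : zmod_morphism canonical_fun.
Proof. by move=> a b; apply: val_inj; apply: funext => i; exact: raddfB. Qed.

HB.instance Definition _ :=
  GRing.isZmodMorphism.Build A (dsum I B) canonical_fun canonical_fun_morph.

Definition canonical_hom : {additive A -> dsum I B} := canonical_fun.

End CanonicalHom.

Fact canonical_hom_morph (I : Type) (A B : zmodType) :
  zmod_morphism (@canonical_hom I A B).
Proof.
by move=> f g; apply: additive_ext => a; apply: val_inj; apply: funext.
Qed.

HB.instance Definition _ (I : Type) (A B : zmodType) :=
  GRing.isZmodMorphism.Build (dsum I {additive A -> B}) {additive A -> dsum I B}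
    (@canonical_hom I A B) (@canonical_hom_morph I A B).

Definition self_small (G : zmodType) : Prop :=
  forall I : Type, bijective (@canonical_hom I G G).

Definition divisible (G : zmodType) (D : zmodClosed G) : Prop :=
  forall (n : nat) (x : G), (0 < n)%N -> x \in D ->
  exists2 y : G, y \in D & y *+ n = x.

Definition reduced (G : zmodType) : Prop :=
  forall D : zmodClosed G, divisible D -> forall x : G, x \in D -> x = 0.

Definition free_group (F : zmodType) : Prop :=
  exists I : Type, group_iso F (dsum I int).

Definition no_free_summand (G : zmodType) : Prop :=
  forall F H : zmodType, free_group F -> group_iso G (F * H)%type ->
  forall x : F, x = 0.

Definition cancellation (G : zmodType) : Prop :=
  forall H K : zmodType,
  group_iso (G * H)%type (G * K)%type -> group_iso H K.

Definition biadditive (A B C : zmodType) (b : A -> B -> C) : Prop :=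
  (forall y, zmod_morphism (b^~ y)) /\ (forall x, zmod_morphism (b x)).

(* The universal property of the tensor product over the integers, [t x y]
   being the pure tensors of [T]. *)
Definition is_tensor (A B T : zmodType) (t : A -> B -> T) : Prop :=
  biadditive t /\
  forall (C : zmodType) (b : A -> B -> C), biadditive b ->
  exists! f : {additive T -> C}, forall x y, f (t x y) = b x y.

(* [V] is Q (x) G, with scalars acting on the left factor. It is a [vectType],
   so the relation holds for no [r] when the rank is infinite. *)
Definition torsion_free_rank (G : zmodType) (r : nat) : Prop :=
  exists (V : vectType rat) (t : rat -> G -> V),
  [/\ is_tensor t,
      forall (a q : rat) (g : G), t (a * q) g = a *: t q g
    & \dim {: V} = r].

(* Main.v *)
(* An abelian group that is reduced, has bounded primary components and has no
   torsion of order dividing [n] is glued to a torsion-free group [X] over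
   [G / n G]. The group [X] is taken with endomorphisms inducing automorphisms
   only by [1] and [-1], with [Hom(G, X) = 0], with only torsion-valued maps
   to [G], and with [X / n X] free of rank large enough to map onto [G / n G].
   For a unit [u] of [End(G)] modulo [n], let [H_u] consist of the pairs
   [(g, x)] for which [u g] and [x] have the same image in [G / n G]. By
   Whitehead's lemma [diag(u, u^-1)] lifts to an automorphism of [G + G], so
   [G + H_u] and [G + H_1] are isomorphic, and cancellation gives
   [H_u = H_1]. Such an isomorphism restricts to an automorphism of
   [n G = G] and induces [1] or [-1] on [X]; comparing both modulo [n] shows
   that it lifts [u] up to sign.

   The group [X] lies in [Q^(m+1)] and is the union of a chain of lattices
   given by an integer vector [a] modulo [N], with [N] growing. Each condition
   on [X] is a countable family of dense open conditions on the limit of the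
   [a]'s, so a Baire category argument meets all of them. For [Hom(G, X) = 0]
   this uses [Hom(G, Z) = 0], that is, the absence of free summands.

   The torsion is removed first: self-smallness makes the primary components
   bounded and the maps from [G] to its torsion part bounded, and the
   [p]-primary component of [G] then splits off. *)
From HB Require Import structures.
Require Import Defs.
From mathcomp Require Import all_boot all_order all_algebra.
From mathcomp Require Import generic_quotient ring_quotient.
From mathcomp Require Import boolp classical_sets functions cardinality.
From mathcomp Require Import ring lra.

Set Implicit Arguments.
Unset Strict Implicit.
Unset Printing Implicit Defensive.

Import Order.TTheory GRing.Theory Num.Theory.
Local Open Scope ring_scope.

(** * Subgroups and self-small groups *)

Lemma subrACA (G : zmodType) (x y u v : G) : (x - y) - (u - v) = (x - u) - (y - v).
Proof. by rewrite !opprB addrACA [RHS]addrACA; congr (_ + _); rewrite addrC. Qed.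

Section AdditiveOf.
Variables (A B : zmodType) (f : A -> B).

(** The additivity proof is a phantom argument, so that the instance below can recover it from the
    term itself. *)
Definition additive_fun of zmod_morphism f := f.

Variable hf : zmod_morphism f.

HB.instance Definition _ :=
  GRing.isZmodMorphism.Build A B (additive_fun hf) hf.

Definition additive_of : {additive A -> B} := additive_fun hf.

End AdditiveOf.

Definition subgroup (G : zmodType) (P : G -> Prop) : Prop :=
  P 0 /\ forall x y, P x -> P y -> P (x - y).

Section SubgroupTheory.
Variables (G : zmodType) (P : G -> Prop) (hP : subgroup P).

Lemma subgroupN x : P x -> P (- x).
Proof. by move=> Px; rewrite -sub0r; apply: hP.2 => //; exact: hP.1. Qed.

Lemma subgroupD x y : P x -> P y -> P (x + y).
Proof. by move=> Px Py; rewrite -[y]opprK; apply: hP.2 => //; exact: subgroupN. Qed.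

Lemma subgroupMn x n : P x -> P (x *+ n).
Proof.
move=> Px; elim: n => [|n IH]; first by rewrite mulr0n; exact: hP.1.
by rewrite mulrS; exact: subgroupD.
Qed.

Lemma subgroupMz x z : P x -> P (x *~ z).
Proof.
move=> Px; case: z => n; first exact: subgroupMn.
by rewrite NegzE mulrNz; apply: subgroupN; exact: subgroupMn.
Qed.

Lemma subgroup_sum (I : finType) (F : I -> G) :
  (forall i, P (F i)) -> P (\sum_i F i).
Proof.
by move=> PF; apply: big_ind => // [|x y]; [exact: hP.1 | exact: subgroupD].
Qed.

(** Boolean form of a propositional subgroup, the shape that [reduced] and the quotient construction
    require; the proof is an argument so that closure can be inferred. *)
Definition subgroup_pred of subgroup P : {pred G} := fun x => `[< P x >].

Fact subgroup_pred_zmod : zmod_closed (subgroup_pred hP).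
Proof.
split=> [|x y /asboolP Px /asboolP Py]; apply/asboolP; first exact: hP.1.
exact: hP.2.
Qed.

HB.instance Definition _ :=
  GRing.isZmodClosed.Build G (subgroup_pred hP) subgroup_pred_zmod.

Record subgroup_type : Type := SubgroupElt {
  subgroup_val :> G;
  subgroup_valP : subgroup_pred hP subgroup_val
}.

HB.instance Definition _ := [isSub for subgroup_val].
HB.instance Definition _ := [Choice of subgroup_type by <:].
HB.instance Definition _ := [SubChoice_isSubZmodule of subgroup_type by <:].

Definition subgroup_elt x (Px : P x) : subgroup_type :=
  SubgroupElt (asboolT Px : subgroup_pred hP x).

Lemma subgroup_eltP (x : subgroup_type) : P (val x).
Proof. by apply/asboolP; exact: (subgroup_valP x). Qed.

End SubgroupTheory.

Lemma subgroup_torsion (G : zmodType) : subgroup (@torsion_elt G).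
Proof. by split; [exact: torsion_elt0 | exact: torsion_eltB]. Qed.

Lemma common_annihilator (G : zmodType) (I : finType) (x : I -> G) :
  (forall i, torsion_elt (x i)) ->
  exists2 M : nat, (0 < M)%N & forall i, x i *+ M = 0.
Proof.
move=> tx; have /fin_all_exists[k kP] : forall i, exists k, (0 < k)%N /\ x i *+ k = 0.
  by move=> i; have [k k0 xk] := tx i; exists k.
exists (\prod_i k i)%N; first by apply: prodn_gt0 => i; have [] := kP i.
by move=> i; rewrite (bigD1 i) //= mulrnA (kP i).2 mul0rn.
Qed.

(** By Bézout, multiplication by [n] is invertible on elements of order dividing [m]. *)
Lemma mulrn_coprime (G : zmodType) (m n : nat) (x : G) :
  (0 < n)%N -> coprime n m -> x *+ m = 0 -> exists c : nat, x = x *+ (n * c).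
Proof.
move=> n0 /eqP nm xm; have [u v e _] := egcdnP m n0.
by exists u; rewrite mulnC e nm mulrnDr mulr1n [(v * m)%N]mulnC mulrnA xm mul0rn add0r.
Qed.

(** If [h] is nonzero, division with remainder shows that its image is generated by its least
    positive value [d]. Then [h / d] maps onto the integers and is split by sending 1 to [g0], which
    exhibits a free summand of rank one. *)
Lemma no_hom_to_int (G : zmodType) : no_free_summand G ->
  forall h : {additive G -> int}, forall x, h x = 0.
Proof.
move=> nf h.
pose P (d : nat) := `[< (0 < d)%N /\ exists x, h x = d%:Z >].
have [exP|nP x] := pselect (exists d, P d); last first.
  apply/eqP; apply/negPn/negP => hx0; apply: nP; exists `|h x|%N; apply/asboolP.
  split; first by rewrite absz_gt0.
  have [hx|hx] := ger0P (h x); last first.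
    by exists (- x); rewrite raddfN -abszN gez0_abs // oppr_ge0 ltW.
  by exists x; rewrite gez0_abs.
case: (ex_minnP exP) => d /asboolP[d0 [g0 hg0]] dmin.
have hd x : exists z, h x = d%:Z * z.
  have d0' : (d%:Z != 0) by rewrite eqz_nat -lt0n.
  have e := divz_eq (h x) d%:Z.
  have r0 := modz_ge0 (h x) d0'.
  case rE: (modz (h x) d%:Z) r0 => [[|r]|r] // _.
    by exists (divz (h x) d%:Z); rewrite {1}e rE addr0 mulrC.
  have : (r.+1 < d)%N.
    by have := ltz_mod (h x) d0'; rewrite rE.
  rewrite ltnNge dmin //; apply/asboolP; split=> //.
  exists (x - g0 *~ divz (h x) d%:Z).
  by rewrite raddfB raddfMz hg0 {1}e rE -mulrzl intz addrC addKr.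
pose q x := projT1 (cid (hd x)).
have qP x : h x = d%:Z * q x by exact: (projT2 (cid (hd x))).
have dI : injective (fun z : int => d%:Z * z).
  by apply: mulfI; rewrite eqz_nat -lt0n.
have qB : zmod_morphism q.
  by move=> x y; apply: dI => /=; rewrite mulrBr -!qP raddfB.
have hK : subgroup (fun x => h x = 0).
  by split=> [|x y hx hy]; rewrite ?raddf0 // raddfB hx hy subrr.
have q0 : q g0 = 1 by apply: dI; rewrite /= -qP hg0 mulr1.
have qK x : h (x - g0 *~ q x) = 0.
  by rewrite raddfB raddfMz hg0 qP -mulrzl intz mulrC subrr.
pose f x : int * subgroup_type hK := (q x, subgroup_elt hK (qK x)).
have fB : zmod_morphism f.
  move=> x y; congr (_, _); first exact: qB.
  by apply: val_inj; rewrite /= qB mulrzBr subrACA.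
have fbij : bijective (additive_of fB).
  exists (fun u => val u.2 + g0 *~ u.1) => [x|[z k]] /=; first exact: subrK.
  have qk : q (val k + g0 *~ z) = z.
    apply: dI; rewrite /= -qP raddfD raddfMz hg0.
    by have -> := subgroup_eltP k; rewrite add0r -mulrzl intz mulrC.
  congr (_, _); first exact: qk.
  by apply: val_inj; rewrite /= /f /= qk addrK.
have fint : free_group int.
  exists unit.
  have fs (z : int) : fin_supp (fun _ : unit => z).
    by apply/asboolP; exact: finite_finset.
  have kB : zmod_morphism (fun z => DSum (fs z)).
    by move=> x y; apply: val_inj; apply: funext.
  exists (additive_of kB), (fun u => dsum_val u tt) => // u.
  by apply: val_inj; apply: funext => -[].
by have := nf _ _ fint (ex_intro _ (additive_of fB) fbij) 1.
Qed.

(** A pointwise finite family is one additive map from [G] to the direct sum of copies of [G].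
    Surjectivity of the canonical homomorphism makes it a finitely supported family. *)
Lemma self_small_finite (G : zmodType) (f : nat -> {additive G -> G}) :
  self_small G -> (forall x, exists k, forall i, (k <= i)%N -> f i x = 0) ->
  exists k, forall i, (k <= i)%N -> forall x, f i x = 0.
Proof.
move=> ss ff.
have fs x : fin_supp (fun i => f i x).
  have [k kP] := ff x; apply/asboolP.
  apply: sub_finite_set (finite_II k) => i /= fi.
  by rewrite ltnNge; apply/negP => /kP.
have hB : zmod_morphism (fun x => DSum (fs x)).
  by move=> x y; apply: val_inj; apply: funext => i; exact: raddfB.
have [g _ gK] := ss nat.
pose F := g (additive_of hB).
have FE i x : (F i : {additive G -> G}) x = f i x.
  have := congr1 (fun u : {additive G -> dsum nat G} => dsum_val (u x) i)
    (gK (additive_of hB)).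
  by [].
have /asboolP/finite_seqP[s sE] := dsum_valP F.
exists (\max_(i <- s) i).+1 => i ki x.
have Fi : F i = 0.
  apply: contrapT => Fi; have : [set j | F j <> 0]%classic i by [].
  rewrite sE /= => si.
  have : (i <= \max_(j <- s) j)%N by exact: leq_bigmax_seq.
  by rewrite leqNgt ki.
by rewrite -FE Fi.
Qed.

(** * Primary components of self-small groups *)

(** The single step from [e.+1] to [e] iterates, by [bounded_primaryP], to say that [p ^ e] kills
    the whole [p]-primary component. *)
Definition bounded_primary (G : zmodType) : Prop :=
  forall p, prime p ->
  exists e, forall x : G, x *+ (p ^ e.+1) = 0 -> x *+ (p ^ e) = 0.

Lemma bounded_primaryP (G : zmodType) (p e : nat) :
  (forall x : G, x *+ (p ^ e.+1) = 0 -> x *+ (p ^ e) = 0) ->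
  forall k (x : G), x *+ (p ^ k) = 0 -> x *+ (p ^ e) = 0.
Proof.
move=> he k x xk.
have : x *+ (p ^ (k + e)) = 0 by rewrite expnD mulrnA xk mul0rn.
elim: k {xk} => // k IH; rewrite addSn -addnS expnD mulrnA => /he.
by rewrite -mulrnA -expnD; exact: IH.
Qed.

Lemma prime_inverse (p : nat) (l : int) :
  prime p -> ~~ (p%:Z %| l)%Z -> exists u c : int, u * l = 1 + c * p%:Z.
Proof.
move=> pp pl; have : coprimez l p%:Z.
  by rewrite coprimezE coprime_sym prime_coprime.
move=> /coprimezP[[u v] /= e]; exists u, (- v).
by rewrite mulNr -e addrK.
Qed.

Section Independence.
Variables (G : zmodType) (p : nat) (pp : prime p) (w : nat -> G).

Definition lincomb (k : nat) (z : nat -> int) : G := \sum_(i < k) w i *~ z i.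

Lemma lincombB k z z' :
  lincomb k (fun i => z i - z' i) = lincomb k z - lincomb k z'.
Proof. by rewrite /lincomb -sumrB; apply: eq_bigr => i _; rewrite mulrzBr. Qed.

Lemma lincombMz k z c : lincomb k (fun i => z i * c) = lincomb k z *~ c.
Proof. by rewrite /lincomb mulrz_suml; apply: eq_bigr => i _; rewrite mulrzA. Qed.

Lemma lincomb_widen k K z : (k <= K)%N -> (forall i, (k <= i)%N -> z i = 0) ->
  lincomb K z = lincomb k z.
Proof.
move=> kK zk; rewrite /lincomb [RHS](big_ord_widen K (fun i => w i *~ z i)) //.
rewrite [LHS](bigID (fun i : 'I_K => (i < k)%N)) /= [X in _ + X]big1 ?addr0 //.
by move=> i; rewrite -leqNgt => /zk ->; rewrite mulr0z.
Qed.

(** For a subgroup [P] containing [p G], this is linear independence of the [w i] over the field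
    with [p] elements in [G / P]. *)
Definition independent_mod (P : G -> Prop) : Prop :=
  forall k z, P (lincomb k z) -> forall i, (i < k)%N -> (p%:Z %| z i)%Z.

(** If the last coefficient of a relation were prime to [p], its inverse modulo [p] would express
    the last vector through the earlier ones modulo [P]. *)
Lemma independent_step (P : G -> Prop) (hP : subgroup P) :
  (forall y, P (y *+ p)) -> (forall k z, ~ P (w k - lincomb k z)) ->
  independent_mod P.
Proof.
move=> pP wP; elim=> [//|k IH] z; rewrite /lincomb big_ord_recr /= => Pz.
have pk : (p%:Z %| z k)%Z.
  apply: contrapT => /negP /(prime_inverse pp)[u [c e]].
  apply: (wP k (fun i => z i * - u)); rewrite lincombMz mulrNz opprK.
  have := subgroupMz hP u Pz; rewrite mulrzDl -mulrzA mulrC e mulrzDr mulr1z.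
  rewrite mulrC mulrzA => Pu.
  have := hP.2 _ _ Pu (subgroupMz hP c (pP (w k))).
  by rewrite -pmulrn addrA addrK addrC.
have Pk : P (lincomb k z).
  have /dvdzP[q qE] := pk; have := hP.2 _ _ Pz (subgroupMz hP q (pP (w k))).
  by rewrite qE mulrC mulrzA addrK.
move=> i; rewrite ltnS leq_eqVlt => /orP[/eqP->//|ik]; exact: IH Pk _ ik.
Qed.

(** Zorn's lemma gives a complement in [G / p G] to the span of the [w i]: a maximal subgroup modulo
    which they stay independent. *)
Lemma maximal_complement :
  independent_mod (fun x => exists y, x = y *+ p) ->
  exists C : G -> Prop, [/\ subgroup C, forall y, C (y *+ p), independent_mod C
    & forall g, exists k z, C (g - lincomb k z)].
Proof.
move=> wind.
pose good (A : set G) := [/\ subgroup A, forall y, A (y *+ p) & independent_mod A].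
have [F FP Ftot|A [PA Amax]] := @Zorn_bigcup G (fun A => A = set0 \/ good A).
  have Fgood B x : F B -> B x -> good B.
    by move=> FB Bx; have [B0|//] := FP B FB; rewrite B0 in Bx.
  have [[B FB [x Bx]]|nF] := pselect (exists2 B, F B & exists x, B x); last first.
    left; rewrite -subset0 => x [B FB Bx]; apply: nF; exists B => //.
    by exists x.
  have [sB pB _] := Fgood _ _ FB Bx.
  right; split.
  - split=> [|a b [B1 FB1 B1a] [B2 FB2 B2b]]; first by exists B => //; exact: sB.1.
    have [B12|B21] := Ftot _ _ FB1 FB2.
      exists B2 => //; have [s2 _ _] := Fgood _ _ FB2 B2b.
      by apply: s2.2 => //; exact: B12.
    exists B1 => //; have [s1 _ _] := Fgood _ _ FB1 B1a.
    by apply: s1.2 => //; exact: B21.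
  - by move=> y; exists B.
  - move=> k z [B1 FB1 B1z]; have [_ _] := Fgood _ _ FB1 B1z; exact.
have gp : good (fun x => exists y, x = y *+ p).
  split=> //; last by move=> y; exists y.
  split=> [|x y [x' ->] [y' ->]]; first by exists 0; rewrite mul0rn.
  by exists (x' - y'); rewrite mulrnBl.
have [A0|[sA pA iA]] := PA.
  case: (Amax _ _ (or_intror gp)); rewrite A0; split; first by move=> x.
  by move=> /(_ 0) /=; apply; exists 0; rewrite mul0rn.
exists A; split=> // g; apply: contrapT => ng.
pose A' : set G := fun x => exists l : int, A (x - g *~ l).
have AA' : (A `<=` A')%classic by move=> x Ax; exists 0; rewrite mulr0z subr0.
apply: (Amax A'); first split=> //.
  move=> /(_ g) A'g; apply: ng; exists 0%N, (fun=> 0).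
  rewrite /lincomb big_ord0 subr0; apply: A'g.
  by exists 1; rewrite mulr1z subrr; exact: sA.1.
right; split.
- split=> [|a b [l Al] [l' Al']]; first by apply: AA'; exact: sA.1.
  exists (l - l'); rewrite mulrzBr subrACA; exact: sA.2.
- by move=> y; exact: AA'.
move=> k z [l Al].
have [/dvdzP[q lE]|/negP/(prime_inverse pp)[u [c e]]] := pselect (p%:Z %| l)%Z.
  apply: iA; have := subgroupD sA Al (subgroupMz sA q (pA g)).
  by rewrite lE mulrC mulrzA subrK.
case: ng; exists k, (fun i => z i * u); rewrite lincombMz.
have := subgroupN sA (subgroupMz sA u Al).
rewrite mulrzBl opprB -mulrzA mulrC e mulrzDr mulr1z mulrC mulrzA => Ag.
have := sA.2 _ _ Ag (subgroupMz sA c (pA g)).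
by rewrite -pmulrn (addrAC g) addrK.
Qed.

(** Modulo the complement [C] the [w i] form a basis over the field with [p] elements. Coordinates
    are therefore defined modulo [p], which is enough to multiply them by [t]. *)
Lemma coordinate_homs (t : G) : t *+ p = 0 ->
  independent_mod (fun x => exists y, x = y *+ p) ->
  exists f : nat -> {additive G -> G},
    (forall x, exists k, forall i, (k <= i)%N -> f i x = 0) /\
    forall i, f i (w i) = t.
Proof.
move=> tp /maximal_complement[C [sC pC iC Cspan]].
pose rep g z := exists k, (forall i, (k <= i)%N -> z i = 0) /\
  forall K, (k <= K)%N -> C (g - lincomb K z).
have repE g : exists z, rep g z.
  have [k [z Cz]] := Cspan g.
  pose z' i := if (i < k)%N then z i else 0.
  have z'0 i : (k <= i)%N -> z' i = 0 by rewrite /z' ltnNge => ->.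
  exists z', k; split=> // K kK; rewrite (lincomb_widen kK) //.
  suff -> : lincomb k z' = lincomb k z by [].
  by apply: eq_bigr => i _; rewrite /z' ltn_ord.
pose z g := projT1 (cid (repE g)); have zP g : rep g (z g) by exact: projT2.
have tdvd c : (p%:Z %| c)%Z -> t *~ c = 0.
  by move=> /dvdzP[q ->]; rewrite mulrC mulrzA -pmulrn tp mul0rz.
have uniq_rep g z1 z2 : rep g z1 -> rep g z2 -> forall i, t *~ z1 i = t *~ z2 i.
  move=> [k1 [z10 C1]] [k2 [z20 C2]] i; apply/eqP; rewrite -subr_eq0 -mulrzBr.
  apply/eqP; apply: tdvd; pose K := (maxn (maxn k1 k2) i.+1).
  apply: (iC K (fun i => z1 i - z2 i)); last by rewrite leq_maxr.
  rewrite lincombB; have := sC.2 _ _ (C2 K _) (C1 K _).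
  rewrite opprB addrC addrA subrK; apply.
  - by rewrite !leq_max leqnn orbT.
  - by rewrite !leq_max leqnn.
have fB i : zmod_morphism (fun g => t *~ z g i).
  move=> x y; rewrite -mulrzBr;
  apply: (uniq_rep (x - y) (z (x - y)) (fun i => z x i - z y i)) => //.
  have [k1 [z10 C1]] := zP x; have [k2 [z20 C2]] := zP y.
  exists (maxn k1 k2); split=> [j|K]; rewrite geq_max => /andP[h1 h2].
    by rewrite z10 // z20 // subrr.
  by rewrite lincombB subrACA; apply: sC.2; [exact: C1 | exact: C2].
exists (fun i => additive_of (fB i)); split=> [x|i] /=;
  rewrite /additive_of /additive_fun /=.
  by have [k [zk _]] := zP x; exists k => i /zk ->; rewrite mulr0z.
rewrite (uniq_rep (w i) _ (fun j => (j == i)%:R)) ?eqxx ?mulr1z //.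
exists i.+1; split=> [j ij|K iK]; first by rewrite gtn_eqF.
rewrite /lincomb (bigD1 (Ordinal iK)) //= eqxx mulr1z big1 ?addr0 ?subrr.
  exact: sC.1.
by move=> j /negPf; rewrite -val_eqE /= => ->; rewrite mulr0z.
Qed.

End Independence.

(* Otherwise the [p]-primary part [T] has an infinite sequence independent
   modulo [p G], and its coordinate maps into the socle of [T] form an infinite
   pointwise finite family of endomorphisms. *)
Lemma self_small_bounded_primary (G : zmodType) :
  self_small G -> reduced G -> bounded_primary G.
Proof.
move=> ss red p pp.
pose T (x : G) := exists k, x *+ (p ^ k) = 0.
have sT : subgroup T.
  split=> [|x y [k xk] [l yl]]; first by exists 0%N; rewrite mul0rn.
  exists (k + l)%N; rewrite mulrnBl expnD mulrnA xk mul0rn mulnC mulrnA yl.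
  by rewrite mul0rn subrr.
have [[t [tp t0]]|nt] := pselect (exists t : G, t *+ p = 0 /\ t <> 0); last first.
  exists 0%N => x; rewrite expn1 expn0 mulr1n => xp.
  by apply: contrapT => x0; apply: nt; exists x.
pose spans (s : seq G) x := exists z y, x = lincomb (nth 0 s) (size s) z + y *+ p.
(* If finitely many elements of [T] generate it modulo [p G] and [p ^ e] kills them, then [D], which
   is [p ^ e T], satisfies [p D = D]. Being a [p]-group, it is divisible, hence zero. *)
have [[s [sT' sspan]]|ns] := pselect (exists s : seq G,
    (forall x, x \in s -> T x) /\ forall x, T x -> spans s x).
  have [e eP] : exists e, forall x, x \in s -> x *+ (p ^ e) = 0.
    elim: s sT' {sspan} => [|a s IH] sT'; first by exists 0%N.
    have [e eP] := IH (fun x xs => sT' x (mem_behead (xs : x \in behead (a :: s)))).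
    have [k ak] := sT' a (mem_head _ _).
    exists (k + e)%N => x; rewrite inE expnD => /orP[/eqP->|/eP xe].
      by rewrite mulrnA ak mul0rn.
    by rewrite mulnC mulrnA xe mul0rn.
  have Tp x : T x -> exists2 y, T y & x *+ (p ^ e) = y *+ p *+ (p ^ e).
    move=> Tx; have [z [y xE]] := sspan x Tx; exists y.
      have [k yk] : T (y *+ p).
        have -> : y *+ p = x - lincomb (nth 0 s) (size s) z by rewrite xE addrC addKr.
        apply: sT.2 => //; apply: (subgroup_sum sT) => i.
        by apply: (subgroupMz sT); apply: sT'; exact: mem_nth.
      by exists k.+1; rewrite expnS mulrnA.
    rewrite xE mulrnDl {1}/lincomb -sumrMnl big1 ?add0r // => i _.
    by rewrite pmulrn mulrzAC -pmulrn eP ?mul0rz // mem_nth.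
  pose D x := exists2 y, T y & x = y *+ (p ^ e).
  have sD : subgroup D.
    split=> [|x y [x' Tx' ->] [y' Ty' ->]]; first by
      exists 0; rewrite ?mul0rn //; exact: sT.1.
    by exists (x' - y'); rewrite ?mulrnBl //; exact: sT.2.
  have Dp k x : D x -> exists2 y, D y & x = y *+ (p ^ k).
    elim: k x => [|k IH] x Dx; first by exists x.
    have [_ [y Ty ->] ->] := IH x Dx; have [y' Ty' ->] := Tp y Ty.
    exists (y' *+ (p ^ e)); first by exists y'.
    by rewrite expnS mulrnA [y' *+ p *+ _]mulrnAC.
  exists e => x xe; apply: (red (subgroup_pred sD)); last first.
    by apply/asboolP; exists x => //; exists e.+1.
  move=> n d n0 /asboolP Dd.
  have [m [k [mE nE]]] : exists m k, ~~ (p %| m)%N /\ n = (m * p ^ k)%N.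
    have [m pm nE] := pfactor_coprime pp n0.
    exists m, (logn p n); split=> //; by rewrite -prime_coprime.
  have [d1 Dd1 ->] := Dp k d Dd.
  have [d1' Td1' d1E] := Dd1; have [l ld1] := Td1'.
  have [c cE] : exists c, d1 = d1 *+ (m * c).
    apply: (@mulrn_coprime G (p ^ l)).
    - by rewrite lt0n; apply: contraNneq mE => ->; rewrite dvdn0.
    - by rewrite coprime_sym coprimeXl // prime_coprime.
    - by rewrite d1E mulrnAC ld1 mul0rn.
  exists (d1 *+ c); first by apply/asboolP; exact: (subgroupMn sD c Dd1).
  by rewrite nE mulrnA -[d1 *+ c *+ m]mulrnA [(c * m)%N]mulnC -cE.
(* In the other case every finite sequence in [T] misses an element of [T]. The hypothesis on [s] is
   put inside the conclusion so that the choice is total, and iterating it builds [w]. *)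
have pickE (s : seq G) : exists x, T x /\ ((forall y, y \in s -> T y) -> ~ spans s x).
  apply: contrapT => nx; apply: ns; exists s.
  have sTs : forall y, y \in s -> T y.
    apply: contrapT => nsT; apply: nx; exists 0; split=> //; exact: sT.1.
  split=> // x Tx; apply: contrapT => nsx; apply: nx; exists x; split=> //.
pose pk s := projT1 (cid (pickE s)).
have pkP s : T (pk s) /\ ((forall y, y \in s -> T y) -> ~ spans s (pk s)).
  exact: (projT2 (cid (pickE s))).
pose ws := fix ws k := if k is k'.+1 then rcons (ws k') (pk (ws k')) else [::].
pose w k := pk (ws k).
have wsE k : ws k = mkseq w k by elim: k => // k IH; rewrite mkseqS -IH.
have wsT k : forall y, y \in ws k -> T y.
  by rewrite wsE => y /mapP[i _ ->]; exact: (pkP _).1.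
have wind : independent_mod p w (fun x => exists y, x = y *+ p).
  apply: (independent_step pp); last 1 first.
  - move=> k z [y wy]; apply: (pkP (ws k)).2 (wsT k) _; exists z, y.
    have -> : lincomb (nth 0 (ws k)) (size (ws k)) z = lincomb w k z.
      rewrite wsE size_mkseq; apply: eq_bigr => i _; by rewrite nth_mkseq.
    by rewrite -wy addrC subrK.
  - split=> [|x y [x' ->] [y' ->]]; first by exists 0; rewrite mul0rn.
    by exists (x' - y'); rewrite mulrnBl.
  - by move=> y; exists y.
have [f [f0 fw]] := coordinate_homs pp tp wind.
have [k kP] := self_small_finite ss f0.
by case: t0; rewrite -(fw k) kP.
Qed.

(* The family [i! f] is pointwise finite. *)
Lemma self_small_torsion_hom (G : zmodType) (f : {additive G -> G}) :
  self_small G -> (forall x, torsion_elt (f x)) ->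
  exists2 N : nat, (0 < N)%N & forall x, f x *+ N = 0.
Proof.
move=> ss ft.
have fB i : zmod_morphism (fun x => f x *+ i`!).
  by move=> x y; rewrite raddfB mulrnBl.
have [x|k kP] := @self_small_finite G (fun i => additive_of (fB i)) ss.
  have [n n0 fn] := ft x; exists n => i ni /=; rewrite /additive_of /additive_fun.
  have /dvdnP[q ->] : (n %| i`!)%N by apply: dvdn_fact; rewrite n0.
  by rewrite mulnC mulrnA fn mul0rn.
by exists k`!; [exact: fact_gt0 | move=> x; exact: (kP k (leqnn k) x)].
Qed.

(** The elements divisible by every [n] form a divisible subgroup. Indeed, if [x = p ^ e.+1 z], then
    [p ^ e z] does not depend on [z], since two choices differ by an element killed by [p ^ e.+1]
    and so by [p ^ e]; varying [z] shows that [p ^ e z] is again divisible by every [n]. *)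
Lemma reduced_ulm (G : zmodType) : reduced G -> bounded_primary G ->
  forall x : G, (forall n, (0 < n)%N -> exists y, x = y *+ n) -> x = 0.
Proof.
move=> red bp.
pose D (x : G) := forall n, (0 < n)%N -> exists y, x = y *+ n.
have sD : subgroup D.
  split=> [|x y Dx Dy] n n0; first by exists 0; rewrite mul0rn.
  have [x' ->] := Dx n n0; have [y' ->] := Dy n n0.
  by exists (x' - y'); rewrite mulrnBl.
have Dp p x : prime p -> D x -> exists2 y, D y & y *+ p = x.
  move=> pp Dx; have [e eP] := bp p pp.
  have pe k : (0 < p ^ k)%N by rewrite expn_gt0 prime_gt0.
  have [z xz] := Dx (p ^ e.+1)%N (pe _); exists (z *+ p ^ e); last first.
    by rewrite xz -mulrnA expnSr.
  move=> n n0; have pn0 : (0 < p ^ e.+1 * n)%N by rewrite muln_gt0 pe.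
  have [w xw] := Dx _ pn0.
  exists (w *+ p ^ e); apply/eqP; rewrite mulrnAC -subr_eq0 -mulrnBl; apply/eqP.
  by apply: eP; rewrite mulrnBl -xz xw mulrnAC -mulrnA subrr.
move=> x Dx; apply: (red (subgroup_pred sD)); last exact/asboolP.
move=> n d n0 /asboolP Dd.
suff [y Dy yE] : exists2 y, D y & y *+ n = d by exists y => //; exact/asboolP.
elim/ltn_ind: n n0 d Dd => n IH n0 d Dd.
have [n1|n1] := leqP n 1; first by exists d => //; case: n n0 n1 {IH} => [|[]].
have [q nE] := dvdnP (pdiv_dvd n); have pp := pdiv_prime n1.
have [y Dy <-] := Dp _ _ pp Dd.
have q0 : (0 < q)%N by move: n0; rewrite {1}nE muln_gt0 => /andP[].
have qn : (q < n)%N by rewrite [X in (_ < X)%N]nE ltn_Pmulr // prime_gt1.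
have [y' Dy' <-] := IH q qn q0 y Dy.
by exists y' => //; rewrite {1}nE mulrnA.
Qed.

(** * Torsion-free rank *)

Lemma rat_mul_fact (q : rat) (k : nat) : (`|denq q| <= k)%N ->
  q * (k`!)%:R = (numq (q * (k`!)%:R))%:~R.
Proof.
move=> qk; have /dvdnP[c cE] : (`|denq q| %| k`!)%N.
  by apply: dvdn_fact; rewrite qk absz_gt0 denq_neq0.
suff -> : q * (k`!)%:R = (numq q * c%:Z)%:~R by rewrite numq_int.
rewrite cE natrM mulrCA mulrC intrM; congr (_ * _).
by rewrite numqE -[in RHS]absz_denq.
Qed.

(* Localising: the class of [k |-> k! q g] in the group of sequences modulo
   eventually zero ones is biadditive in [q] and [g], and it vanishes at
   [q = 1] only if [g] is torsion. *)
Lemma tensor_rat_kernel (G T : zmodType) (t : rat -> G -> T) (g : G) :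
  is_tensor t -> t 1 g = 0 -> torsion_elt g.
Proof.
move=> [_ tuniv] tg.
pose P (s : nat -> G) := exists k, forall i, (k <= i)%N -> s i = 0.
have sP : subgroup P.
  split=> [|s s' [k sk] [k' sk']]; first by exists 0%N.
  exists (maxn k k') => i; rewrite geq_max => /andP[ki ki'].
  by rewrite -[LHS]/(s i - s' i) sk // sk' // subrr.
pose I : zmodClosed (nat -> G) := subgroup_pred sP.
pose s (q : rat) (x : G) : nat -> G := fun k => x *~ numq (q * (k`!)%:R).
pose b (q : rat) (x : G) : Quotient.quot I := \pi_(Quotient.quot I)%qT (s q x).
have piP u v : P (u - v) ->
    \pi_(Quotient.quot I)%qT u = \pi_(Quotient.quot I)%qT v.
  by move=> uv; apply/eqP; rewrite -Quotient.idealrBE; apply/asboolP.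
have piB u v : \pi_(Quotient.quot I)%qT (u - v) =
    \pi_(Quotient.quot I)%qT u - \pi_(Quotient.quot I)%qT v.
  exact: raddfB.
have bB : biadditive b.
  split=> [x q q'|q x x']; rewrite /b -piB; apply: piP; last first.
    exists 0%N => i _; rewrite -[LHS]/(s q (x - x') i - (s q x i - s q x' i)).
    by rewrite /s mulrzBl subrr.
  exists (maxn `|denq (q - q')| (maxn `|denq q| `|denq q'|)) => i.
  rewrite !geq_max => /and3P[h h1 h2].
  rewrite -[LHS]/(s (q - q') x i - (s q x i - s q' x i)) /s -mulrzBr.
  suff -> : numq ((q - q') * (i`!)%:R) =
      numq (q * (i`!)%:R) - numq (q' * (i`!)%:R) by rewrite subrr.
  apply: (@intr_inj rat); rewrite -rat_mul_fact // intrB -!rat_mul_fact //.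
  by rewrite mulrBl.
have [f [fE _]] := tuniv _ b bB.
have := fE 1 g; rewrite tg raddf0 /b => /esym.
rewrite -(raddf0 (\pi_(Quotient.quot I)%qT)) => /eqP.
rewrite -Quotient.idealrBE subr0 => /asboolP[k kP].
exists k`!; first exact: fact_gt0.
have := kP k (leqnn k).
by rewrite /s mul1r -[(k`!)%:R]/((k`!)%:Z%:~R) numq_int.
Qed.

(** The two properties of the map from [G] to its rationalization that are used below. They pass to
    direct summands with the same [d], so [d] is only an upper bound for the rank. *)
Definition rank_coordinates (G : zmodType) (d : nat)
    (iota : {additive G -> 'rV[rat]_d}) : Prop :=
  (forall x, iota x = 0 -> torsion_elt x) /\
  forall k (f : {additive G -> 'rV[rat]_k}),
    exists M : 'M_(d, k), forall x, f x = iota x *m M.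

Lemma torsion_free_rank_coordinates (G : zmodType) (r : nat) :
  torsion_free_rank G r ->
  exists iota : {additive G -> 'rV[rat]_r}, rank_coordinates iota.
Proof.
move=> [V [t [tT _ dimV]]].
have [[tl tr] tuniv] := tT; case: r / dimV.
pose e := vbasis {: V}.
pose c (v : V) : 'rV[rat]_(\dim {: V}) := \row_i coord e i v.
have cB : zmod_morphism (fun g => c (t 1 g)).
  by move=> x y; apply/rowP => i; rewrite !mxE tr raddfB.
have vE v : v = \sum_i c v 0 i *: e`_i.
  rewrite {1}(coord_vbasis (memvf v)).
  by apply: eq_bigr => i _; rewrite mxE.
exists (additive_of cB); split=> [x|k f].
  move=> cx0; have cx : c (t 1 x) = 0 by exact: cx0.
  apply: (tensor_rat_kernel tT).
  by rewrite [LHS]vE cx big1 // => i _; rewrite mxE scale0r.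
pose b (q : rat) (x : G) : 'rV[rat]_k := q *: f x.
have bB : biadditive b.
  split=> [x q q'|q x x']; rewrite /b; first by rewrite scalerBl.
  by rewrite raddfB scalerBr.
have [F [FE _]] := tuniv _ b bB.
have Fl : scalable F by apply: rat_linear; exact: raddfB.
exists (\matrix_i F e`_i) => x.
rewrite mulmx_sum_row /additive_of /additive_fun /=.
rewrite -[LHS]scale1r -[LHS]/(b 1 x) -FE [X in F X]vE raddf_sum.
by apply: eq_bigr => i _; rewrite Fl rowK.
Qed.

(** * Splitting off torsion *)

Lemma common_denominator (k : nat) (q : 'I_k -> rat) :
  exists2 D : nat, (0 < D)%N &
  exists z : 'I_k -> int, forall i, q i * D%:R = (z i)%:~R.
Proof.
pose D := (\sum_i `|denq (q i)|)%N.
exists D`!; first exact: fact_gt0.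
exists (fun i => numq (q i * (D`!)%:R)) => i; apply: rat_mul_fact.
by rewrite /D (bigD1 i) //= leq_addr.
Qed.

Definition torsion_mod (G : zmodType) (p : nat) (x : G) : Prop :=
  exists y, torsion_elt (x - y *+ p).

Lemma subgroup_torsion_mod (G : zmodType) p : subgroup (@torsion_mod G p).
Proof.
split=> [|x y [x' tx] [y' ty]].
  by exists 0; rewrite mul0rn subr0; exact: torsion_elt0.
by exists (x' - y'); rewrite mulrnBl subrACA; exact: torsion_eltB.
Qed.

Lemma torsion_mulrn (G : zmodType) (x : G) (n : nat) :
  (0 < n)%N -> torsion_elt (x *+ n) -> torsion_elt x.
Proof.
by move=> n0 [k k0 xk]; exists (n * k)%N; rewrite ?muln_gt0 ?n0 // mulrnA.
Qed.

Lemma torsion_subr (G : zmodType) (x y : G) :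
  torsion_elt (x - y) -> torsion_elt y -> torsion_elt x.
Proof.
move=> txy ty; rewrite -(subrK y x).
exact: (subgroupD (subgroup_torsion G) txy ty).
Qed.

(** Linear independence over the field with [p] elements in the quotient of [G] by [T(G) + p G]. *)
Definition torsion_independent (G : zmodType) (p k : nat) (a : 'I_k -> G) : Prop :=
  forall z : 'I_k -> int, torsion_mod p (\sum_i a i *~ z i) ->
  forall i, (p%:Z %| z i)%Z.

Section TorsionBasis.
Variables (G : zmodType) (d : nat) (iota : {additive G -> 'rV[rat]_d}).
Hypothesis iotaP : rank_coordinates iota.
Variables (p : nat) (pp : prime p).

(** Descent: the coefficients of a torsion relation are divisible by [p], and dividing them by [p]
    leaves a torsion relation. They are thus divisible by all powers of [p]. *)
Lemma torsion_independent_eq0 k (a : 'I_k -> G) z :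
  torsion_independent p a -> torsion_elt (\sum_i a i *~ z i) -> forall i, z i = 0.
Proof.
move=> ia tz.
have dvd n : forall z, torsion_elt (\sum_i a i *~ z i) ->
    forall i, ((p ^ n)%N%:Z %| z i)%Z.
  elim: n => [|n IH] {tz}z tz i; first by rewrite expn0 dvd1z.
  have pz j : (p%:Z %| z j)%Z.
    by apply: ia; exists 0; rewrite mul0rn subr0.
  pose z' j := divz (z j) p%:Z.
  have zE j : z j = z' j * p%:Z by rewrite divzK.
  have tz' : torsion_elt (\sum_i a i *~ z' i).
    apply: (@torsion_mulrn _ _ p); first exact: prime_gt0.
    rewrite -sumrMnl; rewrite (eq_bigr (fun i => a i *~ z i)) // => j _.
    by rewrite zE mulrzA.
  by rewrite zE expnSr PoszM dvdz_mul // IH.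
move=> i; apply/eqP; rewrite -absz_eq0; apply: contraTT isT => zi.
have := dvd `|z i|%N z tz i; rewrite dvdzE /= => /dvdn_leq.
rewrite lt0n zi => /(_ isT); rewrite leqNgt ltn_expl //; exact: prime_gt1.
Qed.

(** A rational relation between the vectors [iota (a i)], cleared of denominators, is a torsion
    relation between the [a i]. *)
Lemma torsion_independent_le k (a : 'I_k -> G) :
  torsion_independent p a -> (k <= d)%N.
Proof.
move=> ia; pose A : 'M[rat]_(k, d) := \matrix_i iota (a i).
suff /eqP <- : row_free A by exact: rank_leq_col.
rewrite -kermx_eq0; apply/negPn/negP => /rowV0Pn[q /sub_kermxP qA /negP].
apply; apply/eqP/rowP => i; rewrite mxE.
have [D D0 [z zE]] := common_denominator (q 0).
have tz : torsion_elt (\sum_i a i *~ z i).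
  apply: iotaP.1; rewrite raddf_sum.
  transitivity (D%:R *: (q *m A)); last by rewrite qA scaler0.
  rewrite mulmx_sum_row scaler_sumr; apply: eq_bigr => j _.
  by rewrite rowK scalerA mulrC zE raddfMz scaler_int.
have z0 := torsion_independent_eq0 ia tz i.
apply/eqP; have /eqP := zE i; rewrite z0 mulf_eq0 => /orP[//|].
by rewrite pnatr_eq0 => /eqP D0'; rewrite D0' in D0.
Qed.

(** The bound by [d] gives an independent family of maximal length; an element outside its span
    would extend it. *)
Lemma torsion_basis : exists k (a : 'I_k -> G), torsion_independent p a /\
  forall g, exists z : 'I_k -> int, torsion_mod p (g - \sum_i a i *~ z i).
Proof.
pose P k := `[< exists a : 'I_k -> G, torsion_independent p a >].
have exP : exists k, P k by exists 0%N; apply/asboolP; exists (fun=> 0) => z _ [].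
have Pd k : P k -> (k <= d)%N by move=> /asboolP[a]; exact: torsion_independent_le.
have [k /asboolP[a ia] kmax] := ex_maxnP exP Pd.
have sP := subgroup_torsion_mod G p.
have pP (y : G) : torsion_mod p (y *+ p).
  by exists y; rewrite subrr; exact: torsion_elt0.
exists k, a; split=> // g; apply: contrapT => ng.
suff /kmax : P k.+1 by rewrite ltnn.
apply/asboolP; exists (fun i => oapp a g (unlift ord0 i)) => z.
rewrite big_ord_recl unlift_none /= => tz.
have {}tz : torsion_mod p (g *~ z ord0 + \sum_i a i *~ z (lift ord0 i)).
  by move: tz; congr (torsion_mod _ (_ + _)); apply: eq_bigr => i _; rewrite liftK.
have [pz|/negP/(prime_inverse pp)[u [c e]]] := pselect (p%:Z %| z ord0)%Z.
  have ta : torsion_mod p (\sum_i a i *~ z (lift ord0 i)).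
    have [q qE] := dvdzP pz.
    have := sP.2 _ _ tz (subgroupMz sP q (pP g)).
    by rewrite qE mulrC mulrzA -pmulrn addrC addKr.
  by move=> i; case: (unliftP ord0 i) => [j|] -> //; exact: (ia _ ta).
case: ng; exists (fun i => - (z (lift ord0 i) * u)).
have := sP.2 _ _ (subgroupMz sP u tz) (subgroupMz sP c (pP g)).
rewrite mulrzDl -mulrzA [z ord0 * u]mulrC e mulrzDr mulr1z mulrC mulrzA -pmulrn.
rewrite addrAC addrK mulrz_suml; congr (torsion_mod _ (_ + _)).
by rewrite -sumrN; apply: eq_bigr => i _; rewrite mulrNz opprK mulrzA.
Qed.

(* If [p^e] kills the [p]-primary part [B] and the [a i] are a basis of [G]
   modulo [B + p G], then the complement of [B] is generated by the [a i] and
   [p^e G]. *)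
Lemma split_prime : bounded_primary G ->
  exists (C : zmodType) (i : {additive C -> G}) (pr : {additive G -> C}) (e : nat),
  [/\ cancel i pr, forall c : C, c *+ p = 0 -> c = 0
    & forall x, (x - i (pr x)) *+ (p ^ e) = 0].
Proof.
move=> bp; have [e eP] := bp p pp.
have [k [a [ia aspan]]] := torsion_basis.
pose B (x : G) := x *+ (p ^ e) = 0.
pose L (z : 'I_k -> int) := \sum_i a i *~ z i.
pose C (x : G) := exists z g, x = L z + g *+ (p ^ e).
have LB z z' : L (fun i => z i - z' i) = L z - L z'.
  by rewrite /L -sumrB; apply: eq_bigr => i _; rewrite mulrzBr.
have LM z n : L (fun i => z i * n%:Z) = L z *+ n.
  by rewrite /L -sumrMnl; apply: eq_bigr => i _; rewrite mulrzA.
have LD z z' : L (fun i => z i + z' i) = L z + L z'.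
  by rewrite /L -big_split; apply: eq_bigr => i _; rewrite mulrzDr.
have BB x y : B x -> B y -> B (x - y).
  by rewrite /B mulrnBl => -> ->; rewrite subrr.
have BD x y : B x -> B y -> B (x + y).
  by rewrite /B mulrnDl => -> ->; rewrite addr0.
have sC : subgroup C.
  split=> [|x y [z [g ->]] [z' [g' ->]]].
    exists (fun=> 0), 0; rewrite mul0rn addr0 /L big1 //.
  exists (fun i => z i - z' i), (g - g').
  by rewrite LB mulrnBl opprD addrACA.
have step g : exists z b y, B b /\ g = L z + b + y *+ p.
  have [z [y ty]] := aspan g.
  have [t [gE [n n0 tn]]] : exists t, g = L z + t + y *+ p /\ torsion_elt t.
    exists (g - L z - y *+ p); split=> //.
    by rewrite -addrA subrK addrC subrK.
  (* The multiple [p ^ j] of [t] has order dividing [m], which is prime to [p], so [p * c] fixes it.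
     Hence [t - p c t] lies in the [p]-primary part, while [p c t] is absorbed into [p G]. *)
  have [m pm nE] := pfactor_coprime pp n0; set j := logn p n in nE.
  have [c cE] : exists c, t *+ (p ^ j) = t *+ (p ^ j) *+ (p * c).
    apply: (mulrn_coprime (prime_gt0 pp) pm).
    by rewrite -mulrnA mulnC -nE.
  exists z, (t - t *+ (p * c)), (y + t *+ c); split.
    apply: (bounded_primaryP eP (k := j)).
    by rewrite mulrnBl {1}cE -!mulrnA [(p ^ j * _)%N]mulnC subrr.
  rewrite gE mulrnDl -mulrnA [(c * p)%N]mulnC [y *+ p + _]addrC [RHS]addrA.
  by rewrite -[X in _ = X + _]addrA subrK.
have decomp n g : exists z b y, B b /\ g = L z + b + y *+ (p ^ n).
  elim: n g => [|n IH] g.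
    exists (fun=> 0), 0, g; rewrite expn0 mulr1n /B mul0rn /L big1 ?add0r //.
  have [z [b [y [Bb ->]]]] := IH g; have [z' [b' [y' [Bb' ->]]]] := step y.
  exists (fun i => z i + z' i * (p ^ n)%N%:Z), (b + b' *+ (p ^ n)), y'; split.
    by apply: BD => //; rewrite /B mulrnAC Bb' mul0rn.
  by rewrite LD LM !mulrnDl -mulrnA -expnS !addrA [L z + b + _]addrAC.
have disj x : C x -> B x -> x = 0.
  move=> [z [g xE]] Bx.
  have tX n (X : G) : x = X *+ (p ^ n) -> torsion_elt X.
    move=> xX; exists (p ^ n * p ^ e)%N.
      by rewrite muln_gt0 !expn_gt0 prime_gt0.
    by rewrite mulrnA -xX.
  have peel n : (n <= e)%N -> exists z', x = (L z' + g *+ (p ^ (e - n))) *+ (p ^ n).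
    elim: n => [_|n IH ne]; first by exists z; rewrite subn0 expn0 mulr1n.
    have [z' xz'] := IH (ltnW ne).
    have pz' i : (p%:Z %| z' i)%Z.
      apply: ia; exists (- (g *+ (p ^ (e - n.+1)))).
      rewrite mulNrn opprK -mulrnA -expnSr subnSK //.
      exact: (tX n).
    exists (fun i => divz (z' i) p%:Z).
    rewrite {1}xz' expnS mulrnA; congr (_ *+ _).
    rewrite mulrnDl -LM -mulrnA -expnSr subnSK //; congr (_ + _).
    by apply: eq_bigr => i _; rewrite divzK.
  have [z' xz'] := peel e (leqnn e); rewrite xz'.
  apply: (bounded_primaryP eP (k := (e + e)%N)).
  by rewrite expnD mulrnA -xz'.
have dec g : exists b, B b /\ C (g - b).
  have [z [b [y [Bb gE]]]] := decomp e g; exists b; split=> //.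
  by exists z, y; rewrite {1}gE (addrAC (L z)) addrK.
have [b bP] := choice dec.
have bU g c : B c -> C (g - c) -> b g = c.
  move=> Bc Cc; apply/eqP; rewrite -subr_eq0; apply/eqP; apply: disj.
    have := sC.2 _ _ Cc (bP g).2.
    by rewrite opprB addrC addrA subrK.
  exact: BB (bP g).1 Bc.
pose f g := subgroup_elt sC (bP g).2.
have fB : zmod_morphism f.
  move=> x y; have bB : b (x - y) = b x - b y.
    apply: bU; first exact: (BB _ _ (bP x).1 (bP y).1).
    by rewrite subrACA; apply: sC.2; [exact: (bP x).2 | exact: (bP y).2].
  by apply: val_inj => /=; rewrite bB subrACA.
have vB : zmod_morphism (fun x : subgroup_type sC => val x) by [].
exists (subgroup_type sC), (additive_of vB), (additive_of fB), e; split.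
- move=> x; apply: val_inj; rewrite /= (bU _ 0) ?subr0 //.
    by rewrite /B mul0rn.
  exact: subgroup_eltP.
- move=> c cp; apply: val_inj; apply: disj; first exact: subgroup_eltP.
  apply: (bounded_primaryP eP (k := 1%N)); rewrite expn1.
  by rewrite -raddfMn cp.
- by move=> x; rewrite /= opprB addrC subrK; exact: (bP x).1.
Qed.

End TorsionBasis.

(** Consequences of the hypotheses in a form inherited by direct summands, since the torsion is
    removed by passing to one. *)
Record tame (G : zmodType) : Prop := Tame {
  tame_reduced : reduced G;
  tame_bounded : bounded_primary G;
  tame_int : forall (h : {additive G -> int}) x, h x = 0;
  tame_cancel : cancellation G;
  tame_rank : exists d (iota : {additive G -> 'rV[rat]_d}), rank_coordinates iota
}.

(** * Passing to direct summands *)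

Section Summand.
Variables (G C : zmodType) (i : {additive C -> G}) (pr : {additive G -> C}).
Hypothesis iK : cancel i pr.

Lemma summand_reduced : reduced G -> reduced C.
Proof.
move=> red D Ddiv x Dx.
pose P (y : G) := exists2 x, x \in D & y = i x.
have sP : subgroup P.
  split=> [|y y' [c Dc ->] [c' Dc' ->]]; first by exists 0; rewrite ?rpred0 ?raddf0.
  by exists (c - c'); rewrite ?rpredB ?raddfB.
suff ix0 : i x = 0 by rewrite -(iK x) ix0 raddf0.
apply: (red (subgroup_pred sP)); last by apply/asboolP; exists x.
move=> n y n0 /asboolP[c Dc ->]; have [c' Dc' <-] := Ddiv n c n0 Dc.
by exists (i c'); rewrite ?raddfMn //; apply/asboolP; exists c'.
Qed.

(** Adding the complement of [C] in [G] to both sides turns an isomorphism for [C] into one for [G].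
    The complement is never formed: [x - i (pr x)] is its component. *)
Lemma summand_cancellation : cancellation G -> cancellation C.
Proof.
move=> can H K [f [g fK gK]]; apply: can.
pose F (u : G * H) : G * K :=
  let v := f (pr u.1, u.2) in (u.1 - i (pr u.1) + i v.1, v.2).
pose F' (u : G * K) : G * H :=
  let v := g (pr u.1, u.2) in (u.1 - i (pr u.1) + i v.1, v.2).
have prE x c : pr (x - i (pr x) + i c) = c.
  by rewrite raddfD raddfB !iK subrr add0r.
have FB : zmod_morphism F.
  move=> u v; rewrite /F.
  have -> : (pr (u - v).1, (u - v).2) = (pr u.1, u.2) - (pr v.1, v.2).
    by rewrite -[RHS]/(pr u.1 - pr v.1, u.2 - v.2) raddfB.
  rewrite (raddfB f) -[(u - v).1]/(u.1 - v.1) (raddfB pr) (raddfB i) subrACA.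
  move: (f (pr u.1, u.2)) (f (pr v.1, v.2)) => a b.
  rewrite -[(a - b).1]/(a.1 - b.1) (raddfB i).
  by congr (_, _); rewrite addrACA -opprD.
exists (additive_of FB), F' => -[x h] /=; rewrite /additive_of /additive_fun /F /F' /=.
  rewrite prE -surjective_pairing fK /=; congr (_, _).
  by rewrite addrK subrK.
rewrite prE -surjective_pairing gK /=; congr (_, _).
by rewrite addrK subrK.
Qed.

Lemma summand_tame : tame G -> tame C.
Proof.
move=> [red bp hint can [d [iota [ker hom]]]]; split.
- exact: summand_reduced.
- move=> p pp; have [e eP] := bp p pp; exists e => x xe.
  by apply: (can_inj iK); rewrite raddf0 raddfMn eP // -raddfMn xe raddf0.
- by move=> h x; have := hint (h \o pr) (i x); rewrite /= iK.
- exact: summand_cancellation.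
exists d, (iota \o i); split=> [x /= /ker[n n0 xn]|k f].
  by exists n => //; apply: (can_inj iK); rewrite raddf0 raddfMn.
by have [M MP] := hom k (f \o pr); exists M => x; rewrite /= -MP /= iK.
Qed.

End Summand.

Lemma prime_induction (P : nat -> Prop) : P 1%N ->
  (forall p n, prime p -> (0 < n)%N -> P n -> P (p * n)%N) ->
  forall n, (0 < n)%N -> P n.
Proof.
move=> P1 PM; elim/ltn_ind=> n IH n0.
have [n1|n1] := leqP n 1; first by have -> : n = 1%N by case: n n0 n1 {IH} => [|[]].
have [q nE] := dvdnP (pdiv_dvd n); have pp := pdiv_prime n1.
have q0 : (0 < q)%N by move: n0; rewrite {1}nE muln_gt0 => /andP[].
rewrite nE mulnC; apply: PM => //; apply: IH => //.
by rewrite [X in (_ < X)%N]nE ltn_Pmulr // prime_gt1.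
Qed.

(** One primary component is split off for each prime factor of [N]. The complement of [C] is killed
    by [M] and [C] has no [M]-torsion, so the complement has only the zero map to [C]. *)
Lemma split_torsion (N : nat) : (0 < N)%N -> forall G : zmodType, tame G ->
  exists (C : zmodType) (i : {additive C -> G}) (pr : {additive G -> C}) (M : nat),
  [/\ (0 < M)%N, tame C, cancel i pr,
      forall c : C, c *+ N = 0 \/ c *+ M = 0 -> c = 0
    & forall x, (x - i (pr x)) *+ M = 0].
Proof.
move: N; apply: prime_induction => [|p n pp n0 IH] G tG.
  exists G, (idfun : {additive G -> G}), (idfun : {additive G -> G}), 1%N.
  by split=> // [c []|x] //; rewrite /= subrr mul0rn.
have [C [i [pr [M [M0 tC iK Cn CM]]]]] := IH G tG.
have [d [iota iotaP]] := tame_rank tC.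
have [C' [j [qr [e [jK Cp CM']]]]] := split_prime iotaP pp (tame_bounded tC).
exists C', (i \o j), (qr \o pr), (M * p ^ e)%N; split.
- by rewrite muln_gt0 M0 expn_gt0 prime_gt0.
- exact: summand_tame jK tC.
- by move=> c; rewrite /= iK jK.
- have Cpe k c : c *+ (p ^ k) = 0 -> c = 0 :> C'.
    elim: k => [|k IHk]; first by rewrite expn0 mulr1n.
    by rewrite expnSr mulrnA => /Cp.
  move=> c [cpn|cMp].
    apply: Cp; apply: (can_inj jK); rewrite raddf0 raddfMn; apply: Cn; left.
    by rewrite -mulrnA -raddfMn cpn raddf0.
  apply: (Cpe e); apply: (can_inj jK); rewrite raddf0 raddfMn; apply: Cn; right.
  by rewrite -mulrnA -raddfMn mulnC cMp raddf0.
move=> x /=.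
have -> : x - i (j (qr (pr x))) = (x - i (pr x)) + i (pr x - j (qr (pr x))).
  by rewrite raddfB addrA subrK.
rewrite mulrnDl mulrnA CM mul0rn add0r mulnC mulrnA -(raddfMn i) CM' raddf0.
by rewrite mul0rn.
Qed.

(** * Finite generation modulo N *)

Definition spanned (G : zmodType) (s : seq G) (x : G) : Prop :=
  forall P : G -> Prop, subgroup P -> (forall y, y \in s -> P y) -> P x.

Lemma spannedP (G : zmodType) (s : seq G) (x : G) : spanned s x ->
  exists z : 'I_(size s) -> int, x = \sum_(i < size s) s`_i *~ z i.
Proof.
move=> /(_ (fun x => exists z : 'I_(size s) -> int,
  x = \sum_(i < size s) s`_i *~ z i)); apply=> [|y /(nthP 0)[k ks <-]].
  split=> [|u v [z ->] [z' ->]].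
    by exists (fun=> 0); rewrite big1.
  exists (fun i => z i - z' i); rewrite -sumrB.
  by apply: eq_bigr => i _; rewrite mulrzBr.
exists (fun i => (val i == k)%:Z); rewrite (bigD1 (Ordinal ks)) //= eqxx mulr1z.
by rewrite big1 ?addr0 // => i; rewrite -val_eqE /= => /negPf ->; rewrite mulr0z.
Qed.

(** Without [p]-torsion, the order of a torsion element may be taken prime to [p], and then [p] is
    invertible on it. The prime factors of [N] are treated in turn. *)
Lemma torsion_divisible (G : zmodType) (N : nat) : (0 < N)%N ->
  (forall x : G, x *+ N = 0 -> x = 0) ->
  forall t : G, torsion_elt t -> exists2 s, torsion_elt s & t = s *+ N.
Proof.
move: N; apply: prime_induction => [|p n pp n0 IH] GN t tt; first by exists t.
have Gp (x : G) j : x *+ (p ^ j) = 0 -> x = 0.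
  elim: j x => [|j IHj] x; first by rewrite expn0 mulr1n.
  rewrite expnSr mulrnA => xp; apply: IHj; apply: GN.
  by rewrite mulrnA xp mul0rn.
have [s ts ->] : exists2 s, torsion_elt s & t = s *+ p.
  have [k k0 tk] := tt; have [m pm kE] := pfactor_coprime pp k0.
  have tm : t *+ m = 0 by apply: (Gp _ (logn p k)); rewrite -mulrnA -kE.
  have [c tE] := mulrn_coprime (prime_gt0 pp) pm tm.
  exists (t *+ c); last by rewrite -mulrnA mulnC.
  exact: (subgroupMn (subgroup_torsion G) c tt).
have Gn (x : G) : x *+ n = 0 -> x = 0.
  by move=> xn; apply: GN; rewrite mulnC mulrnA xn mul0rn.
by have [s' ts' ->] := IH Gn s ts; exists s' => //; rewrite -mulrnA mulnC.
Qed.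

(** For a prime, a torsion basis generates, because torsion lies in [p G]. Generators modulo [p] and
    modulo [n] together generate modulo [p * n]. *)
Lemma finitely_generated_mod (G : zmodType) (N : nat) : (0 < N)%N ->
  (exists d (iota : {additive G -> 'rV[rat]_d}), rank_coordinates iota) ->
  (forall x : G, x *+ N = 0 -> x = 0) ->
  exists s : seq G, forall g, exists h, spanned s (g - h *+ N).
Proof.
move=> N0 [d [iota iotaP]]; move: N N0; apply: prime_induction => [|p n pp n0 IH] GN.
  by exists [::] => g; exists g; rewrite mulr1n subrr => P [].
have [s sP] : exists s : seq G, forall g, exists h, spanned s (g - h *+ p).
  have [k [a [_ aspan]]] := torsion_basis iotaP pp.
  exists (codom a) => g; have [z [y ty]] := aspan g.
  have Gp (x : G) : x *+ p = 0 -> x = 0.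
    by move=> xp; apply: GN; rewrite mulrnA xp mul0rn.
  have [t _ tE] := torsion_divisible (prime_gt0 pp) Gp ty.
  exists (y + t) => P sP aP; rewrite mulrnDl -tE [y *+ p + _]addrC subrK.
  rewrite opprB addrC subrK.
  by apply: (subgroup_sum sP) => i; apply: (subgroupMz sP); apply: aP; exact: codom_f.
have Gn (x : G) : x *+ n = 0 -> x = 0.
  by move=> xn; apply: GN; rewrite mulnC mulrnA xn mul0rn.
have [s' sP'] := IH Gn.
exists (s ++ s') => g; have [h gh] := sP g; have [h' hh'] := sP' h.
exists h' => P PP Ps.
have -> : g - h' *+ (p * n) = (g - h *+ p) + (h - h' *+ n) *+ p.
  by rewrite mulrnBl addrA subrK -mulrnA mulnC.
apply: (subgroupD PP); first by apply: gh => // y ys; apply: Ps; rewrite mem_cat ys.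
apply: (subgroupMn PP); apply: hh' => // y ys.
by apply: Ps; rewrite mem_cat ys orbT.
Qed.

(** * Chains of lattices *)

(** The Baire category argument in sequential form: the requirements are enumerated by [unpickle],
    and each stage refines the previous one so as to meet the next requirement. *)
Lemma generic_chain (S : Type) (R : S -> S -> Prop) (I : countType)
    (ok : I -> S -> Prop) (s0 : S) :
  (forall s, R s s) -> (forall s s' s'', R s s' -> R s' s'' -> R s s'') ->
  (forall i s, exists s', R s s' /\ ok i s') ->
  exists s : nat -> S,
    (forall j k, (j <= k)%N -> R (s j) (s k)) /\ forall i, exists j, ok i (s j).
Proof.
move=> Rr Rt step.
pose nxt j s := if unpickle j is Some i then projT1 (cid (step i s)) else s.
pose s := fix s j := if j is j'.+1 then nxt j' (s j') else s0.
exists s; split=> [j k|i].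
  elim: k => [|k IH]; first by rewrite leqn0 => /eqP ->.
  rewrite leq_eqVlt => /orP[/eqP ->//|/IH] /Rt; apply.
  rewrite /= /nxt; case: (unpickle k) => // i.
  exact: (projT2 (cid (step i (s k)))).1.
exists (pickle i).+1; rewrite /= /nxt pickleK.
exact: (projT2 (cid (step i _))).2.
Qed.

Lemma rat_int_divisible (r : rat) (N : nat) : (0 < N)%N ->
  (forall k, r / (N * k.+1)%:R \is a Num.int) -> r = 0.
Proof.
move=> N0 rP.
have rint : r \is a Num.int.
  have := rP 0%N; rewrite muln1 => /rpredM /(_ (rpred_nat _ N)).
  by rewrite mulfVK // pnatr_eq0 -lt0n.
have /intrP[z zE] := rint.
(* With this index the divisor exceeds the absolute value of [z]. *)
have /intrP[y yE] := rP `|z|%N.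
have n0 : (N * `|z|.+1)%:R != 0 :> rat by rewrite pnatr_eq0 -lt0n muln_gt0 N0.
have zy : z = y * (N * `|z|.+1)%N%:Z.
  by apply: (@intr_inj rat); rewrite intrM -yE zE mulfVK.
suff z0 : z = 0 by rewrite zE z0.
have := congr1 absz zy; rewrite abszM /= => e.
case: (posnP `|y|%N) => [y0|y0].
  by move: e; rewrite y0 mul0n => /eqP; rewrite absz_eq0 => /eqP.
have : (`|z| < `|y| * (N * `|z|.+1))%N.
  by rewrite -ltnS -[X in (X < _)%N]mul1n ltnS mulnA leq_mul // muln_gt0 y0.
by rewrite -e ltnn.
Qed.

Section Lattices.
Variable m : nat.
Implicit Types (N : nat) (a : 'I_m -> int) (u : 'rV[rat]_m.+1).

(* The lattice generated by the unit vectors and [(1, -a) / N]. *)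
Definition lattice N a u : Prop :=
  u 0 ord0 * N%:R \is a Num.int /\
  forall i, u 0 (lift ord0 i) + u 0 ord0 * (a i)%:~R \is a Num.int.

(** The pair [s] stores the modulus minus one, which keeps the modulus positive. It stands for the
    neighbourhood of [s.2] modulo [s.1.+1] among tuples of profinite integers, and refining shrinks
    this neighbourhood. *)
Definition refines (s s' : nat * ('I_m -> int)) : Prop :=
  (s.1.+1 %| s'.1.+1)%N /\ forall i, exists z, s'.2 i = s.2 i + z * s.1.+1%:Z.

Lemma refines_refl s : refines s s.
Proof. by split=> // i; exists 0; rewrite mul0r addr0. Qed.

Lemma refines_trans s s' s'' : refines s s' -> refines s' s'' -> refines s s''.
Proof.
move=> [d a1] [d' a2]; split=> [|i]; first exact: dvdn_trans d d'.
have [z ->] := a2 i; have [z' ->] := a1 i; have /dvdnP[c ->] := d.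
by exists (z' + z * c%:Z); rewrite PoszM mulrA mulrDl addrA.
Qed.

Lemma lattice_mono s s' u : refines s s' ->
  lattice s.1.+1 s.2 u -> lattice s'.1.+1 s'.2 u.
Proof.
move=> [/dvdnP[c cE] sa] [uN ua]; split=> [|i].
  by rewrite cE mulnC natrM mulrA rpredM // rpred_nat.
have [z ->] := sa i; rewrite intrD mulrDr addrA rpredD //.
by rewrite intrM mulrCA -pmulrn rpredM // rpred_int.
Qed.

(** Once the modulus clears the denominator of the first coordinate, later stages cannot add the
    vector. This makes failure of membership an open condition. *)
Lemma lattice_local s s' u : refines s s' -> u 0 ord0 * s.1.+1%:R \is a Num.int ->
  lattice s'.1.+1 s'.2 u -> lattice s.1.+1 s.2 u.
Proof.
move=> [_ sa] uN [_ ua]; split=> // i.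
have [z zE] := sa i; have := ua i; rewrite zE intrD mulrDr addrA => h.
rewrite -(rpredDr _ (_ : u 0 ord0 * (z * s.1.+1%:Z)%:~R \is a Num.int)) //.
by rewrite intrM mulrCA -pmulrn rpredM // rpred_int.
Qed.

(** Two refinements with the same modulus, large enough to clear the denominator of the first
    coordinate, have entries differing by [s.1.+1]. Subtracting their congruences shows that the
    first coordinate times [s.1.+1] is an integer. *)
Lemma lattice_refine (i0 : 'I_m) s u :
  (forall s', refines s s' -> u 0 ord0 * s'.1.+1%:R \is a Num.int ->
     lattice s'.1.+1 s'.2 u) ->
  lattice s.1.+1 s.2 u.
Proof.
move=> su; pose d := `|denq (u 0%R ord0)|%N.
have d0 : (0 < d)%N by rewrite absz_gt0 denq_neq0.
pose N' := (s.1.+1 * d).-1.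
have N'E : N'.+1 = (s.1.+1 * d)%N by rewrite prednK // muln_gt0.
have uN' : u 0 ord0 * N'.+1%:R \is a Num.int.
  rewrite N'E mulnC natrM mulrA rpredM ?rpred_nat //.
  by rewrite -[d%:R]/(d%:Z%:~R) absz_denq -numqE rpred_int.
have r1 : refines s (N', s.2).
  by split=> [|i] /=; [rewrite N'E dvdn_mulr | exists 0; rewrite mul0r addr0].
have r2 : refines s (N', fun i => s.2 i + s.1.+1%:Z).
  by split=> [|i] /=; [rewrite N'E dvdn_mulr | exists 1; rewrite mul1r].
have [_ h1] := su _ r1 uN'; have [_ /(_ i0) h2] := su _ r2 uN'.
split=> //; move: h2; rewrite /= intrD mulrDr addrA rpredDl //; exact: h1.
Qed.

Definition unit_vec (j : 'I_m.+1) : 'rV[rat]_m.+1 := delta_mx 0 j.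

Definition slope_vec a : 'rV[rat]_m.+1 :=
  \row_j oapp (fun i => - (a i)%:~R) 1 (unlift ord0 j).

Lemma slope_vec0 a : slope_vec a 0 ord0 = 1.
Proof. by rewrite mxE unlift_none. Qed.

Lemma slope_vecS a i : slope_vec a 0 (lift ord0 i) = - (a i)%:~R.
Proof. by rewrite mxE liftK. Qed.

Lemma scale_vecE c u j : (c *: u) 0 j = c * u 0 j.
Proof. by rewrite mxE. Qed.

Lemma sub_vecE u u' j : (u - u') 0 j = u 0 j - u' 0 j.
Proof. by rewrite !mxE. Qed.

Lemma add_vecE u u' j : (u + u') 0 j = u 0 j + u' 0 j.
Proof. by rewrite mxE. Qed.

Lemma lattice_unit N a j : lattice N a (unit_vec j).
Proof.
by split=> [|i]; rewrite !mxE ?rpredD ?rpredM ?rpred_nat ?rpred_int.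
Qed.

Lemma lattice_slope N a : (0 < N)%N -> lattice N a (N%:R^-1 *: slope_vec a).
Proof.
move=> N0; split=> [|i]; rewrite !scale_vecE slope_vec0 mulr1.
  by rewrite mulVf ?rpred1 // pnatr_eq0 -lt0n.
by rewrite slope_vecS mulrN addNr rpred0.
Qed.

Lemma row_eq_lift u u' : u 0 ord0 = u' 0 ord0 ->
  (forall i, u 0 (lift ord0 i) = u' 0 (lift ord0 i)) -> u = u'.
Proof.
by move=> h0 hS; apply/rowP => j; case: (unliftP ord0 j) => [i|] ->.
Qed.

(** Each coordinate of [u] plus the corresponding [a i] times the first coordinate is an integer
    multiple of every [N * k.+1], hence zero. *)
Lemma slope_vec_scale N a u :
  (0 < N)%N -> (forall k, lattice (N * k.+1) a ((N * k.+1)%:R^-1 *: u)) ->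
  u = u 0 ord0 *: slope_vec a.
Proof.
move=> N0 Lu; apply: row_eq_lift => [|i]; rewrite scale_vecE ?slope_vec0 ?mulr1 //.
rewrite slope_vecS mulrN; apply/eqP; rewrite -addr_eq0; apply/eqP.
apply: (rat_int_divisible N0) => k; have [_ /(_ i)] := Lu k.
by rewrite !scale_vecE -mulrA -mulrDr mulrC.
Qed.

Lemma slope_vec_sum a :
  slope_vec a = unit_vec ord0 - \sum_i unit_vec (lift ord0 i) *~ a i.
Proof.
have e j : (\sum_i unit_vec (lift ord0 i) *~ a i) 0 j =
    \sum_i (unit_vec (lift ord0 i) 0 j) *~ a i.
  by rewrite summxE; apply: eq_bigr => i _; rewrite -scaler_int mxE mulrzl.
apply: row_eq_lift => [|k]; rewrite ?slope_vec0 ?slope_vecS !mxE e.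
  by rewrite big1 ?subr0 // => i _; rewrite mxE mul0rz.
rewrite (bigD1 k) //= big1 ?addr0 => [|i ik]; rewrite mxE eqxx /=.
  by rewrite eqxx sub0r.
by rewrite (inj_eq lift_inj) eq_sym (negPf ik) mul0rz.
Qed.

(** With [v] equal to [N] times a unit vector, [w], [w - v] and [w - 2 v] are eigenvectors in
    arithmetic progression; comparing two coordinates shows that their eigenvalues agree. So [v] has
    the eigenvalue of [w], and these vectors span. *)
Lemma scalar_of_slopes (i0 : 'I_m) N a (F : 'M[rat]_m.+1) : (0 < N)%N ->
  (forall z : 'I_m -> int, exists c,
     slope_vec (fun i => a i + z i * N%:Z) *m F =
     c *: slope_vec (fun i => a i + z i * N%:Z)) ->
  exists c, F = c%:M.
Proof.
move=> N0 HF.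
have N0' : N%:R != 0 :> rat by rewrite pnatr_eq0 -lt0n.
pose w := slope_vec a.
have [q qE] : exists q, w *m F = q *: w.
  have [q] := HF (fun=> 0); have -> : (fun i => a i + 0 * N%:Z) = a.
    by apply: funext => i; rewrite mul0r addr0.
  by exists q.
have FS i : unit_vec (lift ord0 i) *m F = q *: unit_vec (lift ord0 i).
  have [v vE] : exists v, v = N%:R *: unit_vec (lift ord0 i) by eexists.
  have vt (t : nat) : exists c, (w - t%:R *: v) *m F = c *: (w - t%:R *: v).
    have [c] := HF (fun j => ((j == i) * t)%N%:Z).
    suff -> : slope_vec (fun j => a j + ((j == i) * t)%N%:Z * N%:Z) = w - t%:R *: v.
      by exists c.
    apply: row_eq_lift => [|j]; rewrite ?slope_vec0 ?slope_vecS vE !mxE.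
      by rewrite unlift_none /= !mulr0 subr0.
    rewrite liftK /= (inj_eq lift_inj) /= intrD opprD PoszM intrM.
    by ring.
  have [q1 q1E] := vt 1%N; have [q2 q2E] := vt 2%N.
  have e : 2%:R *: (q1 *: (w - 1%:R *: v)) = q *: w + q2 *: (w - 2%:R *: v).
    rewrite -q1E -q2E -qE -mulmxDl scalemxAl; congr (_ *m _).
    by rewrite !scaler_nat mulrnBl mulr1n mulr2n addrA.
  have v0 : v 0 ord0 = 0 by rewrite vE !mxE mulr0.
  have vi : v 0 (lift ord0 i) = N%:R by rewrite vE !mxE !eqxx mulr1.
  have e0 : 2%:R * q1 = q + q2.
    have := congr1 (fun x : 'rV[rat]_m.+1 => x 0 ord0) e.
    by rewrite !(scale_vecE, sub_vecE, add_vecE, v0, slope_vec0) !(mulr0, subr0, mulr1).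
  have ei : q1 = q2.
    have := congr1 (fun x : 'rV[rat]_m.+1 => x 0 (lift ord0 i)) e.
    have wi : w 0 (lift ord0 i) = - (a i)%:~R by exact: slope_vecS.
    rewrite !(scale_vecE, sub_vecE, add_vecE) vi wi => ee; apply: (mulIf N0').
    have qE' : q = 2%:R * q1 - q2 by rewrite e0 addrK.
    by rewrite qE' in ee; lra.
  have qq1 : q = q1.
    by move: e0; rewrite -ei mulr_natl mulr2n => /addIr.
  have : v *m F = q *: v.
    have -> : v = w - (w - 1%:R *: v) by rewrite scale1r opprB addrC subrK.
    by rewrite mulmxBl q1E qE -qq1 -scalerBr.
  rewrite vE -scalemxAl scalerA mulrC -scalerA.
  by move/(scalerI N0').
exists q; apply/row_matrixP => j; rewrite !rowE mul_mx_scalar.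
case: (unliftP ord0 j) => [i|] ->; first exact: FS.
have wE : unit_vec ord0 = w + \sum_i unit_vec (lift ord0 i) *~ a i.
  by rewrite /w slope_vec_sum subrK.
rewrite -/(unit_vec ord0) wE mulmxDl scalerDr qE; congr (_ + _).
rewrite mulmx_suml scaler_sumr; apply: eq_bigr => i _.
by rewrite -!scaler_int -scalemxAl FS scalerA mulrC -scalerA.
Qed.

End Lattices.

(** * The group glued to G *)

(* The properties of the torsion-free group [X] that is glued to [G]; the
   [e i] are free generators of [X] modulo [n X] for every [n > 0]. *)
Record rigid_partner (G X : zmodType) (m : nat) (e : 'I_m -> X) : Prop := {
  partner_span : forall n x, (0 < n)%N ->
    exists (z : 'I_m -> int) y, x = \sum_i e i *~ z i + y *+ n;
  partner_free : forall n (z : 'I_m -> int) y, (0 < n)%N ->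
    \sum_i e i *~ z i = y *+ n -> forall i, (n%:Z %| z i)%Z;
  partner_aut : forall f : {additive X -> X}, (forall y, exists x, f x = y) ->
    (forall x, f x = x) \/ (forall x, f x = - x);
  partner_from : forall (f : {additive G -> X}) g, f g = 0;
  partner_to : forall (f : {additive X -> G}) x, torsion_elt (f x)
}.

Lemma rat_valued_hom (G : zmodType) (f : G -> rat) :
  (forall (h : {additive G -> int}) x, h x = 0) -> zmod_morphism f ->
  (forall x, f x \is a Num.int) -> forall x, f x = 0.
Proof.
move=> h0 fB fint.
have /choice[h hE] : forall x, exists z : int, f x = z%:~R.
  by move=> x; have /intrP := fint x.
have hB : zmod_morphism h.
  by move=> x y; apply: (@intr_inj rat); rewrite intrB -!hE fB.
by move=> x; have hx : h x = 0 := h0 (additive_of hB) x; rewrite hE hx.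
Qed.

Section Partner.
Variables (G : zmodType) (d : nat) (iota : {additive G -> 'rV[rat]_d}).
Hypothesis iotaP : rank_coordinates iota.
Hypothesis hint : forall (h : {additive G -> int}) x, h x = 0.
Hypothesis ulm : forall x : G,
  (forall n, (0 < n)%N -> exists y, x = y *+ n) -> x = 0.
Variable m' : nat.
Let m := m'.+1.
Let i0 : 'I_m := ord0.
Implicit Types s : nat * ('I_m -> int).

(** Preimages under [iota]. Through them the countably many rational matrices account for all maps
    from [X] to [G] up to torsion. *)
Variable rep : 'rV[rat]_d -> G.
Hypothesis repP : forall g, iota (rep (iota g)) = iota g.

(** [M] is the matrix of a potential map from [G] to [X]. The integrality clause makes the failure
    of membership permanent, by [lattice_local]. *)
Definition avoids_hom_from (M : 'M[rat]_(d, m.+1)) s : Prop :=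
  (forall g, iota g *m M = 0) \/
  exists g, (iota g *m M) 0 ord0 * s.1.+1%:R \is a Num.int /\
    ~ lattice s.1.+1 s.2 (iota g *m M).

(** If no refinement works, all values already lie in the lattice at [s]. The first coordinate times
    the modulus is then an integer-valued map, hence zero, after which the other coordinates are
    integer-valued too. *)
Lemma avoids_hom_from_step M s :
  exists s', refines s s' /\ avoids_hom_from M s'.
Proof.
apply: contrapT => ns.
have [M0|nM0] := pselect (forall g, iota g *m M = 0).
  by apply: ns; exists s; split; [exact: refines_refl | left].
have L g : lattice s.1.+1 s.2 (iota g *m M).
  apply: (lattice_refine i0) => s' ss' gint; apply: contrapT => nL.
  by apply: ns; exists s'; split=> //; right; exists g.
have B (j : 'I_m.+1) : zmod_morphism (fun g => (iota g *m M) 0 j).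
  by move=> x y; rewrite raddfB mulmxBl sub_vecE.
have q0 g : (iota g *m M) 0 ord0 = 0.
  have := @rat_valued_hom G (fun g => (iota g *m M) 0 ord0 * s.1.+1%:R) hint.
  move=> H; apply: (mulIf (_ : s.1.+1%:R != 0)); first by rewrite pnatr_eq0.
  rewrite mul0r; apply: H => [x y|x]; first by rewrite B mulrBl.
  by have [] := L x.
apply: nM0 => g; apply: row_eq_lift => [|i]; rewrite [RHS]mxE //.
apply: (rat_valued_hom hint (B _)) => x.
by have [_ /(_ i)] := L x; rewrite q0 mul0r addr0.
Qed.

(* A map from [X] to [G] is only determined modulo torsion by its matrix, so
   the index [c] also records a multiplier killing the torsion differences
   between the images of the unit vectors and their representatives. *)
Definition representatives (c : nat * 'M[rat]_(m.+1, d)) (j : 'I_m.+1) : G :=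
  rep (row j c.2) *+ c.1.+1.

(** [X] contains the vector [(1, -a)] divided by the modulus, so a map from [X] to [G] would make
    the displayed combination divisible by the modulus. *)
Definition avoids_hom_to (c : nat * 'M[rat]_(m.+1, d)) s : Prop :=
  (forall j, torsion_elt (representatives c j)) \/
  ~ exists h, representatives c ord0 -
      \sum_i representatives c (lift ord0 i) *~ s.2 i = h *+ s.1.+1.

(** Otherwise the combination is divisible by every [n] for every tuple congruent to [s.2], so it
    vanishes by [ulm]. Changing one entry by the modulus shows that each [g (lift ord0 k)] is
    torsion, and then so is [g ord0]. *)
Lemma avoids_hom_to_step c s : exists s', refines s s' /\ avoids_hom_to c s'.
Proof.
apply: contrapT => ns.
pose g j := representatives c j.
have div (z : 'I_m -> int) :
    g ord0 - \sum_i g (lift ord0 i) *~ (s.2 i + z i * s.1.+1%:Z) = 0.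
  apply: ulm => n n0; apply: contrapT => nh.
  have nE : (s.1.+1 * n).-1.+1 = (s.1.+1 * n)%N by rewrite prednK // muln_gt0.
  apply: ns; exists ((s.1.+1 * n).-1, fun i => s.2 i + z i * s.1.+1%:Z).
  split; first by split=> [|i]; [rewrite /= nE dvdn_mulr | exists (z i)].
  right=> -[h hE]; apply: nh; exists (h *+ s.1.+1).
  by rewrite -mulrnA -nE; exact: hE.
have g1 k : g (lift ord0 k) *+ s.1.+1 = 0.
  have h0 := div (fun=> 0); have h1 := div (fun i => (i == k)%:Z).
  have : (\sum_i g (lift ord0 i) *~ (s.2 i + (i == k)%:Z * s.1.+1%:Z)) -
      \sum_i g (lift ord0 i) *~ (s.2 i + 0 * s.1.+1%:Z) = 0.
    apply/eqP; rewrite subr_eq0; apply/eqP; apply: oppr_inj.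
    by apply: (addrI (g ord0)); rewrite h0 h1.
  rewrite -sumrB (bigD1 k) //= big1 ?addr0 => [|i /negPf ik].
    by rewrite eqxx mul1r mulrzDr addrC addKr.
  by rewrite ik mul0r subrr.
have tS k : torsion_elt (g (lift ord0 k)) by exists s.1.+1.
apply: ns; exists s; split; first exact: refines_refl.
left=> j; case: (unliftP ord0 j) => [i|] -> //.
apply: (@torsion_subr _ _ (\sum_i g (lift ord0 i) *~ (s.2 i + 0 * s.1.+1%:Z))).
  by rewrite (div (fun=> 0)); exact: torsion_elt0.
apply: (subgroup_sum (subgroup_torsion G)) => i.
exact: (subgroupMz (subgroup_torsion G)).
Qed.

Definition avoids_endo (F : 'M[rat]_m.+1) s : Prop :=
  (exists c, F = c%:M) \/
  exists u, [/\ lattice s.1.+1 s.2 u, (u *m F) 0 ord0 * s.1.+1%:R \is a Num.int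
    & ~ lattice s.1.+1 s.2 (u *m F)].

(** Otherwise [F] preserves the lattices of all refinements. Letting the modulus grow with [a] fixed
    makes every slope vector an eigenvector, so [F] is scalar. *)
Lemma avoids_endo_step F s : exists s', refines s s' /\ avoids_endo F s'.
Proof.
apply: contrapT => ns.
have L s' u : refines s s' -> lattice s'.1.+1 s'.2 u ->
    lattice s'.1.+1 s'.2 (u *m F).
  move=> ss' Lu; apply: (lattice_refine i0) => s'' ss'' uint.
  apply: contrapT => nL; apply: ns; exists s''; split.
    exact: refines_trans ss' ss''.
  by right; exists u; split=> //; exact: lattice_mono ss'' Lu.
apply: ns; exists s; split; first exact: refines_refl.
left; apply: (scalar_of_slopes i0 (N := s.1.+1) (a := s.2)) => // z.
pose a i := s.2 i + z i * s.1.+1%:Z; exists ((slope_vec a *m F) 0 ord0).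
apply: (slope_vec_scale (N := s.1.+1)) => // k.
pose s' := ((s.1.+1 * k.+1).-1, a).
have N' : s'.1.+1 = (s.1.+1 * k.+1)%N by rewrite prednK.
have := L s' _ _ (lattice_slope s'.2 (ltn0Sn s'.1)).
rewrite N' -scalemxAl; apply.
by split=> [|i]; [rewrite N' dvdn_mulr | exists (z i)].
Qed.

(** Meeting this for all [n] makes every positive integer divide some modulus of the chain, as
    generation of [X] modulo [n X] requires. *)
Definition avoids_nondivisor (n : nat) s : Prop := (0 < n)%N -> (n %| s.1.+1)%N.

Lemma avoids_nondivisor_step n s :
  exists s', refines s s' /\ avoids_nondivisor n s'.
Proof.
have [-> |n0] := posnP n; first by exists s; split=> //; exact: refines_refl.
have nE : (s.1.+1 * n).-1.+1 = (s.1.+1 * n)%N by rewrite prednK // muln_gt0.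
exists ((s.1.+1 * n).-1, s.2); split; last by move=> _; rewrite /= nE dvdn_mull.
split=> [|i] /=; first by rewrite nE dvdn_mulr.
by exists 0; rewrite mul0r addr0.
Qed.

Lemma exists_rigid_partner_rep :
  exists (X : zmodType) (e : 'I_m -> X), rigid_partner G e.
Proof.
pose I : countType := (nat + 'M[rat]_(d, m.+1) + (nat * 'M[rat]_(m.+1, d))
  + 'M[rat]_m.+1)%type.
pose ok (i : I) s := match i with
  | inl (inl (inl n)) => avoids_nondivisor n s
  | inl (inl (inr M)) => avoids_hom_from M s
  | inl (inr c) => avoids_hom_to c s
  | inr F => avoids_endo F s
  end.
have [|s [sR sok]] := @generic_chain _ (@refines m) I ok (0%N, fun=> 0)
    (@refines_refl m) (@refines_trans m).
  case=> [[[n|M]|c]|F] s; [exact: avoids_nondivisor_step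
    | exact: avoids_hom_from_step | exact: avoids_hom_to_step
    | exact: avoids_endo_step].
pose P (u : 'rV[rat]_m.+1) := exists j, lattice (s j).1.+1 (s j).2 u.
have Pmono j k u : (j <= k)%N -> lattice (s j).1.+1 (s j).2 u ->
    lattice (s k).1.+1 (s k).2 u.
  by move=> /sR; exact: lattice_mono.
have Ploc j u : P u -> u 0 ord0 * (s j).1.+1%:R \is a Num.int ->
    lattice (s j).1.+1 (s j).2 u.
  move=> [k Lu] uint; apply: (lattice_local (sR j (maxn j k) (leq_maxl _ _))) => //.
  exact: Pmono (leq_maxr _ _) Lu.
have sP : subgroup P.
  split=> [|u v [j Lu] [k Lv]].
    by exists 0%N; split=> [|i]; rewrite !mxE ?mul0r ?addr0.
  have [Lu1 Lu2] := Pmono _ _ _ (leq_maxl j k) Lu.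
  have [Lv1 Lv2] := Pmono _ _ _ (leq_maxr j k) Lv.
  exists (maxn j k); split=> [|i]; rewrite !sub_vecE.
    by rewrite mulrBl rpredB.
  by rewrite mulrBl addrACA -opprD rpredB.
pose X : zmodType := subgroup_type sP.
have Punit j : P (unit_vec j) by exists 0%N; exact: lattice_unit.
pose E j : X := subgroup_elt sP (Punit j).
have XP (x : X) : P (val x) by exact: subgroup_eltP.
have valMn (x : X) n : val (x *+ n) = n%:R *: val x.
  by rewrite raddfMn scaler_nat.
have valD (x y : X) : val (x + y) = val x + val y by [].
have valB (x y : X) : val (x - y) = val x - val y by [].
have valsum k (F : 'I_k -> 'I_m.+1) (z : 'I_k -> int) :
    val (\sum_i E (F i) *~ z i) = \sum_i unit_vec (F i) *~ z i.
  by rewrite raddf_sum; apply: eq_bigr => i _; rewrite raddfMz.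
have sumE k (F : 'I_k -> 'I_m.+1) (z : 'I_k -> int) j :
    (\sum_i unit_vec (F i) *~ z i) 0 j = \sum_i (F i == j)%:R * (z i)%:~R.
  rewrite summxE; apply: eq_bigr => i _.
  by rewrite -scaler_int scale_vecE mxE eqxx eq_sym mulrC.
have XE (x : X) : exists2 D : nat, (0 < D)%N &
    exists z, x *+ D = \sum_j E j *~ z j.
  have [D D0 [z zE]] := common_denominator (fun j => val x 0 j).
  exists D => //; exists z; apply: val_inj; rewrite valMn (valsum _ id).
  apply/rowP => j; rewrite scale_vecE (sumE _ id) (bigD1 j) //= big1.
    by rewrite eqxx mul1r addr0 mulrC zE.
  by move=> i /negPf ->; rewrite mul0r.
exists X, (fun i => E (lift ord0 i)); split.
(* Subtracting from [x] its first coordinate times the slope vector of stage [l] leaves an integer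
   combination of the [e i]. The subtracted vector is divisible by [n] in [X], since the modulus at
   [l] is a multiple of that at [j] times [n]. *)
- move=> n x n0; have [j Lx] := XP x.
  have [k kdvd] := sok (inl (inl (inl ((s j).1.+1 * n)%N))).
  have /dvdnP[c cE] : ((s j).1.+1 * n %| (s k).1.+1)%N.
    by apply: kdvd; rewrite muln_gt0.
  pose l := maxn j k; have [Lx1 Lx2] := Pmono _ _ _ (leq_maxl j k) Lx.
  have /fin_all_exists[z zE] : forall i, exists z : int,
      val x 0 (lift ord0 i) + val x 0 ord0 * ((s l).2 i)%:~R = z%:~R.
    by move=> i; have /intrP := Lx2 i.
  have n0' : n%:R != 0 :> rat by rewrite pnatr_eq0 -lt0n.
  have Py : P ((val x 0 ord0 / n%:R) *: slope_vec (s l).2).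
    exists l; split=> [|i]; rewrite !scale_vecE slope_vec0 mulr1; last first.
      by rewrite slope_vecS mulrN addNr.
    have [Lj _] := Lx.
    have /dvdnP[c' c'E] : ((s j).1.+1 * n %| (s l).1.+1)%N.
      have [+ _] := sR _ _ (leq_maxr j k); apply: dvdn_trans.
      by rewrite cE dvdn_mull.
    have -> : val x 0 ord0 / n%:R * (s l).1.+1%:R =
        val x 0 ord0 * (s j).1.+1%:R * c'%:R by rewrite c'E !natrM; field.
    by rewrite rpredM // rpred_nat.
  exists z, (subgroup_elt sP Py); apply: val_inj; rewrite valD valMn valsum /=.
  rewrite scalerA mulrC mulfVK //.
  apply: row_eq_lift => [|i]; rewrite add_vecE scale_vecE ?slope_vec0 ?slope_vecS sumE.
    by rewrite big1 ?add0r ?mulr1 // => i _; rewrite eq_sym (negPf (neq_lift _ _)) mul0r.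
  rewrite (bigD1 i) //= eqxx mul1r big1 ?addr0 => [|h /negPf hi].
    by rewrite -zE mulrN addrK.
  by rewrite (inj_eq lift_inj) hi mul0r.
(* The first coordinate of [y] is zero, so its other coordinates are integers. *)
- move=> n z y n0 /(congr1 val); rewrite valsum valMn => e i.
  have n0' : n%:R != 0 :> rat by rewrite pnatr_eq0 -lt0n.
  have [j [_ Ly]] := XP y.
  have := congr1 (fun u : 'rV[rat]_m.+1 => u 0 ord0) e.
  rewrite /= sumE scale_vecE big1 => [/esym/eqP|h _]; last first.
    by rewrite eq_sym (negPf (neq_lift _ _)) mul0r.
  rewrite mulf_eq0 (negPf n0') /= => /eqP y0.
  have := congr1 (fun u : 'rV[rat]_m.+1 => u 0 (lift ord0 i)) e.
  rewrite /= sumE scale_vecE (bigD1 i) //= eqxx mul1r big1 => [|h /negPf hi]; last first.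
    by rewrite (inj_eq lift_inj) hi mul0r.
  have := Ly i; rewrite y0 mul0r addr0 addr0 => /intrP[q ->] zq.
  apply/dvdzP; exists q; apply: (@intr_inj rat).
  by rewrite zq intrM mulrC.
(* The matrix of [f] is a scalar [c]. Both [c] and its inverse are integers, because a rational
   multiple of the chosen unit vector lies in [X] only for an integer factor. *)
- move=> f fsurj.
  pose F : 'M[rat]_m.+1 := \matrix_j val (f (E j)).
  have fE x : val (f x) = val x *m F.
    have [D D0 [z zE]] := XE x.
    have D0' : D%:R != 0 :> rat by rewrite pnatr_eq0 -lt0n.
    apply: (scalerI D0'); rewrite -valMn -raddfMn zE scalemxAl -valMn zE.
    rewrite (valsum _ id) mulmx_suml raddf_sum raddf_sum; apply: eq_bigr => j _.
    rewrite !raddfMz -!scaler_int -scalemxAl; congr (_ *: _).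
    by rewrite -rowE rowK.
  have [j [[c cE]|[u [Lu uint nL]]]] := sok (inr F); last first.
    case: nL; apply: (Ploc) => //.
    have Pu : P u by exists j.
    by have := XP (f (subgroup_elt sP Pu)); rewrite fE.
  have fc x : val (f x) = c *: val x by rewrite fE cE mul_mx_scalar.
  have int_of q : P (q *: unit_vec (lift ord0 i0)) -> q \is a Num.int.
    move=> [k [_ /(_ i0)]]; rewrite !scale_vecE !mxE !eqxx /=.
    by rewrite mulr0 mul0r addr0 mulr1.
  have cint : c \is a Num.int.
    by apply: int_of; have := XP (f (E (lift ord0 i0))); rewrite fc.
  have [x xE] := fsurj (E (lift ord0 i0)).
  have cx : c *: val x = unit_vec (lift ord0 i0) by rewrite -fc xE.
  have c0 : c != 0.
    apply/eqP => c0; move: cx; rewrite c0 scale0r.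
    move=> /(congr1 (fun u : 'rV[rat]_m.+1 => u 0 (lift ord0 i0))) /=.
    by rewrite !mxE !eqxx => /eqP; rewrite eq_sym oner_eq0.
  have cVint : c^-1 \is a Num.int.
    apply: int_of; rewrite -cx scalerA mulVf // scale1r; exact: XP.
  have c1 : `|c| = 1.
    have h (q : rat) : q \is a Num.int -> q != 0 -> 1 <= `|q|.
      by move=> /intrP[z ->]; rewrite intr_eq0 -intr_norm ler1z -gtz0_ge1 normr_gt0.
    apply/le_anti; rewrite h // andbT -[X in _ <= X]invr1 -[`|c|]invrK.
    by rewrite lef_pV2 ?posrE ?ltr01 ?invr_gt0 ?normr_gt0 // -normfV h // invr_eq0.
  have [c0'|c0'] := leP 0 c.
    by left=> y; apply: val_inj; rewrite fc -(ger0_norm c0') c1 scale1r.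
  right=> y; apply: val_inj; rewrite raddfN /= fc -[c]opprK.
  by rewrite -(ltr0_norm c0') c1 scaleN1r.
- move=> f g; have vB : zmod_morphism (fun x => val (f x)).
    by move=> x y; rewrite !raddfB.
  have [M ME] := iotaP.2 _ (additive_of vB).
  have fM x : val (f x) = iota x *m M by exact: ME.
  have [j [M0|[x [xint nL]]]] := sok (inl (inl (inr M))).
    by apply: val_inj; rewrite fM M0 raddf0.
  by case: nL; apply: Ploc => //; rewrite -fM; exact: XP.
move=> f.
suff tE j : torsion_elt (f (E j)).
  move=> x; have [D D0 [z zE]] := XE x.
  apply: (torsion_mulrn D0); rewrite -raddfMn zE raddf_sum.
  apply: (subgroup_sum (subgroup_torsion G)) => j; rewrite raddfMz.
  exact: (subgroupMz (subgroup_torsion G)).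
pose R : 'M[rat]_(m.+1, d) := \matrix_j iota (f (E j)).
(* Multiplication by [k] removes the torsion ambiguity of the representatives; the index uses [k.-1]
   because [representatives] adds one. *)
have [j0|k k0 kP] := @common_annihilator G _ (fun j => rep (row j R) - f (E j)).
  by apply: iotaP.1; rewrite rowK raddfB repP subrr.
have rE i : representatives (k.-1, R) i = f (E i) *+ k.
  by rewrite /representatives /= prednK //; apply/eqP; rewrite -subr_eq0 -mulrnBl kP.
have [l [tl|nl]] := sok (inl (inr (k.-1, R))).
  by apply: (torsion_mulrn k0); rewrite -rE.
case: nl; have Py : P ((s l).1.+1%:R^-1 *: slope_vec (s l).2).
  by exists l; exact: lattice_slope.
exists (f (subgroup_elt sP Py) *+ k).
have e : subgroup_elt sP Py *+ (s l).1.+1 =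
    E ord0 - \sum_i E (lift ord0 i) *~ (s l).2 i.
  apply: val_inj; rewrite valMn valB valsum /= -slope_vec_sum scalerA.
  by rewrite mulfV ?scale1r // pnatr_eq0.
rewrite mulrnAC -(raddfMn f) e raddfB (raddf_sum f) mulrnBl rE -sumrMnl.
by congr (_ - _); apply: eq_bigr => i _; rewrite rE raddfMz pmulrn mulrzAC.
Qed.

End Partner.

(** * Gluing *)

Lemma exists_rigid_partner (G : zmodType) (m : nat) : tame G ->
  exists (X : zmodType) (e : 'I_m.+1 -> X), rigid_partner G e.
Proof.
move=> tG; have [d [iota iotaP]] := tame_rank tG.
have /choice[rep repP] : forall v, exists g,
    (exists g', iota g' = v) -> iota g = v.
  by move=> v; have [[g gv]|ng] := pselect (exists g, iota g = v);
     [exists g | exists 0].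
apply: (@exists_rigid_partner_rep G d iota iotaP (tame_int tG) _ m rep).
  exact: (reduced_ulm (tame_reduced tG) (tame_bounded tG)).
by move=> g; apply: repP; exists g.
Qed.

Lemma group_isoP (A B : zmodType) : group_iso A B ->
  exists (f : {additive A -> B}) (g : {additive B -> A}), cancel f g /\ cancel g f.
Proof.
move=> [f [g fK gK]]; have gB : zmod_morphism g.
  by move=> x y; apply: (can_inj fK); rewrite raddfB !gK.
by exists f, (additive_of gB).
Qed.

Lemma factor_through (H X B : zmodType) (p : {additive H -> X})
    (D : {additive H -> B}) :
  (forall x, exists u, p u = x) -> (forall u, p u = 0 -> D u = 0) ->
  exists d : {additive X -> B}, forall u, D u = d (p u).
Proof.
move=> /choice[w wP] D0.
have Dp u v : p u = p v -> D u = D v.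
  move=> puv; apply/eqP; rewrite -subr_eq0 -raddfB; apply/eqP; apply: D0.
  by rewrite raddfB puv subrr.
have dB : zmod_morphism (fun x => D (w x)).
  by move=> x y; rewrite -raddfB; apply: Dp; rewrite raddfB !wP.
by exists (additive_of dB) => u; apply: Dp; rewrite wP.
Qed.

Lemma int_sum_divisible (G : zmodType) (n m : nat) (s : 'I_m -> G) (z : 'I_m -> int) :
  (forall i, (n%:Z %| z i)%Z) -> exists h, \sum_i s i *~ z i = h *+ n.
Proof.
move=> nz; exists (\sum_i s i *~ (z i %/ n%:Z)%Z); rewrite -sumrMnl.
by apply: eq_bigr => i _; rewrite pmulrn -mulrzA divzK.
Qed.

Section Gluing.
Variables (G X : zmodType) (m : nat) (e : 'I_m -> X) (s : 'I_m -> G) (n : nat).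
Hypothesis n0 : (0 < n)%N.
Hypothesis partner : rigid_partner G e.
Hypothesis Gn : forall x : G, x *+ n = 0 -> x = 0.
Hypothesis sP : forall g, exists (z : 'I_m -> int) h, g = \sum_i s i *~ z i + h *+ n.

Lemma mulrn_inj (x y : G) : x *+ n = y *+ n -> x = y.
Proof.
move=> xy; apply/eqP; rewrite -subr_eq0; apply/eqP; apply: Gn.
by rewrite mulrnBl xy subrr.
Qed.

(** The pullback over [G / n G] of [a] and the map from [X] sending [e i] to [s i], with the shared
    coefficients [z] in place of the quotient. *)
Definition glued (a : {additive G -> G}) (u : G * X) : Prop :=
  exists (z : 'I_m -> int) h y,
    a u.1 = \sum_i s i *~ z i + h *+ n /\ u.2 = \sum_i e i *~ z i + y *+ n.

Lemma subgroup_glued a : subgroup (glued a).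
Proof.
split=> [|u v [z [h [y [uE xE]]]] [z' [h' [y' [uE' xE']]]]].
  by exists (fun=> 0), 0, 0; rewrite raddf0 !mul0rn !big1 ?addr0.
exists (fun i => z i - z' i), (h - h'), (y - y').
rewrite -[(u - v).1]/(u.1 - v.1) -[(u - v).2]/(u.2 - v.2) raddfB uE xE uE' xE'.
split; rewrite mulrnBl opprD addrACA; congr (_ + _); rewrite -sumrB;
  by apply: eq_bigr => i _; rewrite mulrzBr.
Qed.

Definition glue a : zmodType := subgroup_type (subgroup_glued a).

Lemma glue_eq a (u v : glue a) :
  (val u).1 = (val v).1 -> (val u).2 = (val v).2 -> u = v.
Proof.
move=> e1 e2; apply: val_inj; move: e1 e2.
by case: (val u) (val v) => [g x] [g' x'] /= -> ->.
Qed.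

Definition glue_fst a : {additive glue a -> G} :=
  [the {additive glue a -> G} of fst \o val].
Definition glue_snd a : {additive glue a -> X} :=
  [the {additive glue a -> X} of snd \o val].

(** Injectivity of the map induced by [a] on [G / n G]. *)
Definition reflects_mulrn (a : {additive G -> G}) : Prop :=
  forall g h, a g = h *+ n -> exists k, g = k *+ n.

(** By freeness of the [e i] modulo [n], a zero second component forces all [z i] to be divisible by
    [n]. *)
Lemma glue_kernel a (u : glue a) : reflects_mulrn a -> (val u).2 = 0 ->
  exists g, (val u).1 = g *+ n.
Proof.
move=> an u0; have [z [h [y [aE xE]]]] := subgroup_eltP u.
have nz : forall i, (n%:Z %| z i)%Z.
  apply: (partner_free partner (y := - y) n0).
  by apply/eqP; rewrite mulNrn -addr_eq0 -xE u0.
have [k kE] := int_sum_divisible s nz.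
by apply: (an _ (k + h)); rewrite aE kE mulrnDl.
Qed.

Lemma glued_mulrn a g : glued a (g *+ n, 0).
Proof.
exists (fun=> 0), (a g), 0; rewrite !big1 //= mul0rn addr0 add0r.
by split=> //; rewrite raddfMn.
Qed.

Definition glue_mulrn a g : glue a := subgroup_elt (subgroup_glued a) (glued_mulrn a g).

Lemma glue_mulrnB a : zmod_morphism (glue_mulrn a).
Proof.
move=> x y; apply: val_inj; rewrite /= mulrnBl.
by apply/eqP; rewrite xpair_eqE subrr !eqxx.
Qed.

(** There is no nonzero map from [G] to [X], so [f] sends the copy of [G] inside the first group to
    elements with zero second component. Division by [n] is unique there. *)
Lemma glue_hom a a' (f : {additive glue a -> glue a'}) : reflects_mulrn a' ->
  exists theta : {additive G -> G},
    forall g, val (f (glue_mulrn a g)) = (theta g *+ n, 0).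
Proof.
move=> a'n.
have f2 g : (val (f (glue_mulrn a g))).2 = 0.
  have B : zmod_morphism (fun g => (val (f (glue_mulrn a g))).2).
    by move=> x y; rewrite glue_mulrnB !raddfB.
  exact: (partner_from partner (additive_of B) g).
have /choice[theta tE] : forall g, exists k, (val (f (glue_mulrn a g))).1 = k *+ n.
  by move=> g; apply: glue_kernel a'n (f2 g).
have tB : zmod_morphism theta.
  by move=> x y; apply: mulrn_inj; rewrite mulrnBl -!tE glue_mulrnB !raddfB.
exists (additive_of tB) => g; rewrite [LHS]surjective_pairing f2.
by congr (_, _); exact: tE.
Qed.

Variables (al be ga ga' : {additive G -> G}).
Hypothesis albe : forall x, al (be x) = x + ga x *+ n.
Hypothesis beal : forall x, be (al x) = x + ga' x *+ n.

Let one : {additive G -> G} := idfun.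

Lemma reflects_one : reflects_mulrn one.
Proof. by move=> g h gE; exists h. Qed.

Lemma reflects_unit : reflects_mulrn al.
Proof.
move=> g h gE; exists (be h - ga' g); rewrite mulrnBl -raddfMn -gE beal.
by rewrite addrK.
Qed.

Lemma glue_onto (a : {additive G -> G}) : (forall y, exists g h, a g = y + h *+ n) ->
  forall x : X, exists u : glue a, glue_snd a u = x.
Proof.
move=> ay x; have [z [y xE]] := partner_span partner x n0.
have [g [h gE]] := ay (\sum_i s i *~ z i).
have P : glued a (g, x) by exists z, h, y.
by exists (subgroup_elt _ P).
Qed.

(* Whitehead's lemma: modulo [n] the map below is the product of elementary
   matrices with value [diag (al, be)]. *)
Lemma glue_iso : group_iso (G * glue al)%type (G * glue one)%type.
Proof.
(* A pair [(r, g)] is sent through [p = r - al g] and [q = g + be p] to [(q, t)] with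
   [t = al q - p]. Modulo [n] this is [(be r, al g)], so the unchanged component in [X] now matches
   [t] itself. *)
pose p (r q : G) := r - al q.
have pB r r' q q' : p (r - r') (q - q') = p r q - p r' q'.
  by rewrite /p raddfB subrACA.
have P1 (r : G) (u : glue al) :
    glued one (al ((val u).1 + be (p r (val u).1)) - p r (val u).1, (val u).2).
  have [z [h [y [uE xE]]]] := subgroup_eltP u.
  exists z, (h + ga (p r (val u).1)), y; split=> //=.
  by rewrite /one /= (raddfD al) albe [p r _ + _]addrC addrA addrK uE mulrnDl addrA.
have P2 (a : G) (u : glue one) :
    glued al (a - be (al a - (val u).1), (val u).2).
  have [z [h [y [uE xE]]]] := subgroup_eltP u.
  exists z, (h - ga (al a - (val u).1)), y; split=> //=.
  rewrite (raddfB al) albe opprD addrA opprB.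
  have -> : al a + ((val u).1 - al a) = (val u).1 by rewrite addrC subrK.
  by rewrite mulrnBl addrA; congr (_ - _); exact: uE.
pose q (v : G * glue al) : G := (val v.2).1 + be (p v.1 (val v.2).1).
pose t (v : G * glue al) : G := al (q v) - p v.1 (val v.2).1.
pose F (v : G * glue al) : G * glue one :=
  (q v, subgroup_elt (subgroup_glued one) (P1 v.1 v.2)).
pose q' (v : G * glue one) : G := v.1 - be (al v.1 - (val v.2).1).
pose F' (v : G * glue one) : G * glue al :=
  (al v.1 - (val v.2).1 + al (q' v), subgroup_elt (subgroup_glued al) (P2 v.1 v.2)).
have qB v w : q (v - w) = q v - q w.
  rewrite /q -[(v - w).1]/(v.1 - w.1) -[(val (v - w).2).1]/((val v.2).1 - (val w.2).1).
  by rewrite pB (raddfB be) opprD addrACA.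
have tB v w : t (v - w) = t v - t w.
  rewrite /t qB -[(v - w).1]/(v.1 - w.1).
  rewrite -[(val (v - w).2).1]/((val v.2).1 - (val w.2).1).
  by rewrite pB (raddfB al) subrACA.
have pairE (A B : Type) (u v : A * B) : u.1 = v.1 -> u.2 = v.2 -> u = v.
  by case: u v => [a b] [a' b'] /= -> ->.
have FB : zmod_morphism F.
  move=> v w; apply: pairE; first exact: qB.
  by apply: glue_eq; first exact: tB.
have altK v : al (q v) - t v = p v.1 (val v.2).1.
  by rewrite /t opprB addrC subrK.
have q'F v : q' (F v) = (val v.2).1.
  by rewrite /q' -[(F v).1]/(q v) -[(val (F v).2).1]/(t v) altK /q addrK.
have pF' v : p (F' v).1 (val (F' v).2).1 = al v.1 - (val v.2).1.
  by rewrite -[(val (F' v).2).1]/(q' v) /p addrK.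
have qF' v : q (F' v) = v.1.
  by rewrite /q pF' -[(val (F' v).2).1]/(q' v) /q' subrK.
exists (additive_of FB), F' => v; apply: pairE.
- rewrite -[LHS]/(al (q v) - t v + al (q' (F v))) altK q'F.
  by rewrite /p subrK.
- by apply: glue_eq; [exact: q'F |].
- exact: qF'.
apply: glue_eq => //; rewrite -[LHS]/(t (F' v)) /t qF' pF'.
by rewrite opprB addrC subrK.
Qed.

Lemma glue_unit : cancellation G ->
  exists (theta theta' eps : {additive G -> G}),
    [/\ cancel theta theta', cancel theta' theta
      & forall x, theta x - al x = eps x *+ n].
Proof.
move=> can; have [f [f' [fK f'K]]] := group_isoP (can _ _ glue_iso).
have [th thE] := glue_hom f reflects_one.
have [th' th'E] := glue_hom f' reflects_unit.
have thK : cancel th th'.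
  move=> g; apply: mulrn_inj.
  have e1 : f (glue_mulrn al g) = glue_mulrn one (th g) by apply: val_inj; exact: thE.
  by have := th'E (th g); rewrite -e1 fK => /(congr1 fst).
have th'K : cancel th' th.
  move=> g; apply: mulrn_inj.
  have e1 : f' (glue_mulrn one g) = glue_mulrn al (th' g) by apply: val_inj; exact: th'E.
  by have := thE (th' g); rewrite -e1 f'K => /(congr1 fst).
have ker (u : glue al) : glue_snd al u = 0 -> exists g, u = glue_mulrn al g.
  move=> u0; have [g gE] := glue_kernel reflects_unit u0.
  by exists g; apply: val_inj; rewrite [LHS]surjective_pairing gE; congr (_, _).
have onto := @glue_onto al (fun y => ex_intro _ (be y) (ex_intro _ (ga y) (albe y))).
have [chi chiE] : exists chi : {additive X -> X},
    forall u, glue_snd one (f u) = chi (glue_snd al u).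
  have := @factor_through _ _ _ (glue_snd al) (glue_snd one \o f) onto.
  apply=> u /ker[g ->].
  by have := congr1 snd (thE g).
(* The first component of [f] agrees with [th] on the kernel of the projection to [X], so the
   discrepancy factors through [X]; it is torsion-valued and hence divisible by [n]. *)
have [del delE] : exists del : {additive X -> G},
    forall u, glue_fst one (f u) - th (glue_fst al u) = del (glue_snd al u).
  have B : zmod_morphism (fun u => glue_fst one (f u) - th (glue_fst al u)).
    move=> u v; rewrite (raddfB f) (raddfB (glue_fst one)) (raddfB (glue_fst al)).
    by rewrite (raddfB th) subrACA.
  have := @factor_through _ _ _ (glue_snd al) (additive_of B) onto.
  apply=> u /ker[g ->].
  have := congr1 fst (thE g); rewrite /= => h.
  by apply/eqP; rewrite subr_eq0; apply/eqP; rewrite [LHS]h raddfMn.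
have chi_onto y : exists x, chi x = y.
  have [|v vy] := @glue_onto one _ y.
    by move=> y'; exists y', 0; rewrite mul0rn addr0.
  by exists (glue_snd al (f' v)); rewrite -chiE f'K.
have [c cc chic] : exists2 c : int, c * c = 1 & forall x, chi x = x *~ c.
  have [h|h] := partner_aut partner chi_onto; first by exists 1.
  by exists (-1) => // x; rewrite h mulrNz.
(* The element [u] pairs [g] with a lift to [X] of the class of [al g]. Membership of [f u] in the
   second glued group compares [th g] with [c] times [al g] modulo [n]. *)
have key g : exists k, th g - al g *~ c = k *+ n.
  have [z [h aE]] := sP (al g).
  have gl : glued al (g, \sum_i e i *~ z i).
    by exists z, h, 0; rewrite mul0rn addr0.
  pose u : glue al := subgroup_elt _ gl.
  have [z' [h' [y' [fE1 fE2]]]] := subgroup_eltP (f u).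
  have e2 : (val (f u)).2 = (\sum_i e i *~ z i) *~ c by rewrite -chic; exact: chiE.
  have e1 : (val (f u)).1 = th g + del (\sum_i e i *~ z i).
    by rewrite -[del _](delE u) addrC subrK.
  have nz : forall i, (n%:Z %| z' i - z i * c)%Z.
    apply: (partner_free partner (n := n) (y := - y') n0).
    have -> : \sum_i e i *~ (z' i - z i * c) =
        \sum_i e i *~ z' i - (\sum_i e i *~ z i) *~ c.
      rewrite mulrz_suml -sumrB; apply: eq_bigr => i _.
      by rewrite mulrzBr mulrzA.
    by rewrite -e2 fE2 opprD addrA subrr add0r mulNrn.
  have [t _ tE] := torsion_divisible n0 Gn (partner_to partner del (\sum_i e i *~ z i)).
  have [k kE] := int_sum_divisible s nz.
  exists (k + h' - h *~ c - t).
  have sE : \sum_i s i *~ z' i = k *+ n + (\sum_i s i *~ z i) *~ c.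
    rewrite -kE mulrz_suml -big_split; apply: eq_bigr => i _.
    by rewrite /= mulrzBr mulrzA subrK.
  have thE' : th g = \sum_i s i *~ z' i + h' *+ n - t *+ n.
    by rewrite -tE -fE1 /= e1 addrK.
  have hE : (h *~ c) *+ n = h *+ n *~ c by rewrite pmulrn mulrzAC.
  rewrite thE' aE sE mulrzDl !mulrnBl mulrnDl hE opprD addrA.
  rewrite (addrAC (k *+ n)) (addrAC _ (- (t *+ n)) (- (_ *~ c))) addrK.
  by rewrite addrAC.
have thcB (th0 : {additive G -> G}) : zmod_morphism (fun g => th0 g *~ c).
  by move=> x y; rewrite raddfB mulrzBl.
(* Since [c * c = 1], moving the sign from [al] to [th] gives a lift of [al] itself. *)
have /choice[eps epsE] : forall g, exists k, th g *~ c - al g = k *+ n.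
  move=> g; have [k kE] := key g; exists (k *~ c).
  by rewrite -[al g]mulr1z -cc mulrzA -mulrzBl kE pmulrn mulrzAC.
have epsB : zmod_morphism eps.
  move=> x y; apply: mulrn_inj.
  by rewrite mulrnBl -!epsE (raddfB th) (raddfB al) mulrzBl subrACA.
exists (additive_of (thcB th)), (additive_of (thcB th')), (additive_of epsB).
split=> [g|g|g]; last exact: epsE.
  by rewrite -[LHS]/(th' (th g *~ c) *~ c) raddfMz thK -mulrzA cc.
by rewrite -[LHS]/(th (th' g *~ c) *~ c) raddfMz th'K -mulrzA cc.
Qed.

End Gluing.

(** * Lifting units *)

Lemma lift_unit_torsion_free (G : zmodType) (n : nat)
    (al be ga ga' : {additive G -> G}) :
  tame G -> (0 < n)%N -> (forall x : G, x *+ n = 0 -> x = 0) ->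
  (forall x, al (be x) = x + ga x *+ n) ->
  (forall x, be (al x) = x + ga' x *+ n) ->
  exists (theta theta' eps : {additive G -> G}),
    [/\ cancel theta theta', cancel theta' theta
      & forall x, theta x - al x = eps x *+ n].
Proof.
move=> tG n0 Gn albe beal.
have [s sP] := finitely_generated_mod n0 (tame_rank tG) Gn.
have [X [e partner]] := exists_rigid_partner (size s) tG.
(* The list is extended by 0 because the partner comes with a positive number of generators. *)
apply: (@glue_unit G X _ e (fun i => (0 :: s)`_i) n n0 partner Gn _
  al be ga ga' albe beal (tame_cancel tG)).
move=> g; have [h gh] := sP g.
have [|z zE] := @spannedP G (0 :: s) (g - h *+ n).
  by move=> P sP' Ps; apply: gh => // y ys; apply: Ps; rewrite inE ys orbT.
by exists z, h; rewrite -zE subrK.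
Qed.

(** On a summand [C] without torsion of order dividing [n * N * N'] the errors [tau] and [tau']
    vanish. The lift found there is extended by the identity on the complement, at the cost of an
    error killed by [M]. *)
Lemma lift_unit (G : zmodType) (n N N' : nat)
    (al be ga ga' tau tau' : {additive G -> G}) :
  tame G -> (0 < n)%N -> (0 < N)%N -> (0 < N')%N ->
  (forall x, tau x *+ N = 0) -> (forall x, tau' x *+ N' = 0) ->
  (forall x, al (be x) = x + ga x *+ n + tau x) ->
  (forall x, be (al x) = x + ga' x *+ n + tau' x) ->
  exists (theta theta' eps : {additive G -> G}),
    [/\ cancel theta theta', cancel theta' theta
      & forall x, torsion_elt (theta x - al x - eps x *+ n)].
Proof.
move=> tG n0 N0 N'0 tauN tauN' albe beal.
have K0 : (0 < n * N * N')%N by rewrite !muln_gt0 n0 N0.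
have [C [i [pr [M [M0 tC iK Cfree prM]]]]] := split_torsion K0 tG.
have CK (c : C) k : (k %| n * N * N')%N -> c *+ k = 0 -> c = 0.
  by move=> /dvdnP[q qE] ck; apply: Cfree; left; rewrite qE mulnC mulrnA ck mul0rn.
have Cn (c : C) : c *+ n = 0 -> c = 0 by apply: CK; rewrite -mulnA dvdn_mulr.
(* The part of [x] outside [C] is killed by [M], so its image in [C] is zero. *)
have prf (f : {additive G -> G}) x : pr (f (i (pr x))) = pr (f x).
  apply/eqP; rewrite eq_sym -subr_eq0 -raddfB -raddfB; apply/eqP.
  by apply: Cfree; right; rewrite -!raddfMn prM !raddf0.
pose res (f : {additive G -> G}) : {additive C -> C} :=
  [the {additive C -> C} of pr \o f \o i].
have [||th [th' [eps [thK th'K epsE]]]] :=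
    @lift_unit_torsion_free C n (res al) (res be) (res ga) (res ga') tC n0 Cn.
- move=> c; rewrite /= prf albe !raddfD iK raddfMn.
  rewrite [pr (tau _)](CK _ N) ?addr0 //.
    by rewrite mulnAC dvdn_mull.
  by rewrite -raddfMn tauN raddf0.
- move=> c; rewrite /= prf beal !raddfD iK raddfMn.
  rewrite [pr (tau' _)](CK _ N') ?addr0 ?dvdn_mull //.
  by rewrite -raddfMn tauN' raddf0.
pose ext (f : {additive C -> C}) (x : G) : G := (x - i (pr x)) + i (f (pr x)).
have extB f : zmod_morphism (ext f).
  move=> x y; rewrite /ext (raddfB pr) (raddfB i) (raddfB f) (raddfB i).
  by rewrite subrACA addrACA -opprD.
have extK (f g : {additive C -> C}) : cancel f g -> cancel (ext f) (ext g).
  move=> fK x; rewrite /ext; set y := _ + i (f _).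
  have -> : pr y = f (pr x) by rewrite raddfD raddfB !iK subrr add0r.
  by rewrite fK /y addrK subrK.
exists (additive_of (extB th)), (additive_of (extB th')).
exists [the {additive G -> G} of i \o eps \o pr].
split=> [||x]; [exact: extK | exact: extK |].
rewrite /= -raddfMn -epsE -[additive_of _ x]/(ext th x) /ext /= prf.
have -> : x - i (pr x) + i (th (pr x)) - al x - i (th (pr x) - pr (al x)) =
    (x - i (pr x)) - (al x - i (pr (al x))).
  rewrite (raddfB i) !opprB; move: (x - _) (i (th _)) (i (pr (al x))) => y u v.
  by rewrite (addrAC y) addrACA subrr addr0 addrAC addrA.
by exists M => //; rewrite mulrnBl !prM subrr.
Qed.

Lemma hom_addE (A B : zmodType) (f g : {additive A -> B}) x : (f + g) x = f x + g x.
Proof. by []. Qed.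

Lemma hom_mulrnE (A B : zmodType) (f : {additive A -> B}) n x :
  (f *+ n) x = f x *+ n.
Proof. by elim: n => // n IH; rewrite !mulrS hom_addE IH. Qed.

Lemma pi_ring_quotMn (R : pzRingType) (I : twoSidedIdeal R) (x : R) n :
  (\pi_(ring_quot I) (x *+ n) = \pi_(ring_quot I) x *+ n)%qT.
Proof.
elim: n => [|n IH]; last by rewrite !mulrS pi_ring_quotD IH.
by rewrite !mulr0n; exact: raddf0.
Qed.

Theorem theorem4p5 (G : zmodType) (r : nat)
    (hred : reduced G) (hsmall : self_small G)
    (hrank : torsion_free_rank G r) (hr : (r <= 4)%N)
    (hfree : no_free_summand G) (hcancel : cancellation G) :
  unit_lifting (walk_End G).
Proof.
have tG : tame G.
  split=> //; [exact: self_small_bounded_primary | exact: no_hom_to_int |].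
  by exists r; exact: torsion_free_rank_coordinates.
pose pi n (a : End G) : ring_quot (@mult_ideal (walk_End G) n) :=
    (\pi_(ring_quot (@mult_ideal (walk_End G) n))
       (\pi_(walk_End G) a : walk_End G))%qT.
(* Unwinding both quotients leaves an identity of endomorphisms up to a multiple of [n] and a
   torsion-valued error, which self-smallness bounds by one integer [N]. *)
have walk_unit (n : nat) (a b : End G) : pi n a * pi n b = 1 ->
    exists (g t : {additive G -> G}) (N : nat), (0 < N)%N /\
      (forall x, t x *+ N = 0) /\
      forall x, (a : {additive G -> G}) ((b : {additive G -> G}) x) =
        x + g x *+ n + t x.
  have e1 (S : pzRingType) (I : twoSidedIdeal S) (x y : S) :
      (\pi_(ring_quot I) x = \pi_(ring_quot I) y)%qT -> x - y \in I.
    by move=> xy; apply/ring_quot_eqP.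
  have e2 (S : pzRingType) (I : twoSidedIdeal S) (x y : S) :
      (\pi_(ring_quot I) (x * y) = \pi_(ring_quot I) x * \pi_(ring_quot I) y)%qT.
    exact: pi_ring_quotM.
  rewrite /pi -e2 => /e1 /asboolP[w]; elim/quotW: w => g.
  rewrite -[X in X - _]e2 => /eqP; rewrite subr_eq addrC => /eqP gE.
  have : (\pi_(walk_End G) (a * b) = \pi_(walk_End G) (1 + g *+ n))%qT.
    by rewrite gE pi_ring_quotD pi_ring_quotMn.
  move=> /e1 /asboolP tT; pose t := a * b - (1 + g *+ n).
  have [N N0 tN] := self_small_torsion_hom hsmall tT.
  exists g, t, N; split=> //; split=> // x.
  have abE : a * b = (1 + g *+ n) + t by rewrite addrC subrK.
  rewrite -hom_mulrnE.
  exact: (congr1 (fun f : End G => (f : {additive G -> G}) x) abE).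
move=> n n0; elim/quotW; elim/quotW=> a [v]; elim/quotW: v; elim/quotW=> b [ab ba].
have [g [t [N [N0 [tN abE]]]]] := walk_unit n a b ab.
have [g' [t' [N' [N'0 [tN' baE]]]]] := walk_unit n b a ba.
have [th [th' [eps [thK th'K epsE]]]] := lift_unit tG n0 N0 N'0 tN tN' abE baE.
exists (\pi_(walk_End G)%qT (th : End G)).
  exists (\pi_(walk_End G)%qT (th' : End G)).
  by split; rewrite -[LHS]pi_ring_quotM; congr (\pi_(_) _)%qT; apply: additive_ext.
apply/ring_quot_eqP; apply/asboolP; exists (\pi_(walk_End G)%qT (eps : End G)).
apply/eqP; rewrite subr_eq -pi_ring_quotMn -pi_ring_quotD; apply/eqP.
apply/ring_quot_eqP; apply/asboolP => x.
rewrite -[X in torsion_elt X]/(th x - ((eps *+ n : {additive G -> G}) x +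
  (a : {additive G -> G}) x)).
by rewrite hom_mulrnE [_ *+ n + _]addrC opprD addrA; exact: epsE.
Qed.
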